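(* Let $\mathcal{G}$ be an étale groupoid, let $\mathscr{A}$ be a $\mathcal{G}$-sheaf, and let $\{\mathscr{Q}_n,\vartheta_n\}_{n\in\mathbb{N}}$ be a resolution of the constant $\mathcal{G}$-sheaf $\underline{\mathbb{Z}}$. Let $c\in Z^n_{\mathscr{Q}}(\mathcal{G},\mathscr{A})$. (1) For $n\ge1$ we have a commuting diagram of $\mathcal{G}$-sheaves with exact rows, for some $\mathcal{G}$-sheaf $\mathscr{R}_c$ and morphisms $\iota$, $\tilde{\vartheta}_{n-1}$, whose top row is $$\cdots\to\mathscr{Q}_{n+1}\xrightarrow{\vartheta_{n+1}}\mathscr{Q}_n\xrightarrow{\vartheta_n}\mathscr{Q}_{n-1}\xrightarrow{\vartheta_{n-1}}\mathscr{Q}_{n-2}\xrightarrow{\vartheta_{n-2}}\cdots\xrightarrow{\vartheta_1}\mathscr{Q}_0\xrightarrow{\vartheta_0}\underline{\mathbb{Z}}\to0,$$ whose bottom row is $$0\to\mathscr{A}\xrightarrow{\iota}\mathscr{R}_c\xrightarrow{\tilde{\vartheta}_{n-1}}\mathscr{Q}_{n-2}\xrightarrow{\vartheta_{n-2}}\cdots\xrightarrow{\vartheta_1}\mathscr{Q}_0\xrightarrow{\vartheta_0}\underline{\mathbb{Z}}\to0,$$ and whose vertical maps are $\mathscr{Q}_{n+1}\to0$, $c:\mathscr{Q}_n\to\mathscr{A}$, a morphism $\mathscr{Q}_{n-1}\to\mathscr{R}_c$, and the identities on $\mathscr{Q}_{n-2},\dots,\mathscr{Q}_0,\underline{\mathbb{Z}}$.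 Moreover, the class of this $n$-fold exact sequence (the bottom row) in $\operatorname{Ext}^n_{\mathcal{G}}(\underline{\mathbb{Z}},\mathscr{A})$ only depends on $[c]\in H^n_{\mathscr{Q}}(\mathcal{G},\mathscr{A})$. (2) For $n=0$ there is a unique $\tilde{c}\in\operatorname{Hom}_{\mathcal{G}}(\underline{\mathbb{Z}},\mathscr{A})$ such that $c=\tilde{c}\circ\vartheta_0$. (3) Furthermore, for all $n\in\mathbb{N}$ we obtain a well-defined homomorphism $$\rho^n_{\mathscr{Q}}:H^n_{\mathscr{Q}}(\mathcal{G},\mathscr{A})\to H^n(\mathcal{G},\mathscr{A})$$ which for $n\ge1$ is given by taking $[c]\in H^n_{\mathscr{Q}}(\mathcal{G},\mathscr{A})$ to the class of the $n$-fold exact sequence in the bottom row of (1), and for $n=0$ is given by $\rho^0_{\mathscr{Q}}([c])=\tilde{c}$ for $c\in Z^0_{\mathscr{Q}}(\mathcal{G},\mathscr{A})$.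
   Context: An étale groupoid is a locally compact Hausdorff topological groupoid whose range and source maps $r,s:\mathcal{G}\to\mathcal{G}^{(0)}$ are local homeomorphisms. A $\mathcal{G}$-sheaf is a space $\mathscr{A}$ with a local homeomorphism $\pi:\mathscr{A}\to\mathcal{G}^{(0)}$ whose fibers $\mathscr{A}(x)=\pi^{-1}(x)$ are abelian groups with continuous fiberwise operations, together with isomorphisms $\alpha_\gamma:\mathscr{A}(s(\gamma))\to\mathscr{A}(r(\gamma))$ for $\gamma\in\mathcal{G}$ with $\alpha_x=\mathrm{id}$ for units, $\alpha_{\gamma_1}\circ\alpha_{\gamma_2}=\alpha_{\gamma_1\gamma_2}$ for composable pairs, and $(\gamma,a)\mapsto\alpha_\gamma(a)$ continuous on $\{(\gamma,a):s(\gamma)=\pi(a)\}$. Morphisms ($\operatorname{Hom}_{\mathcal{G}}$) are continuous maps preserving fibers over each point, fiberwise homomorphisms, and commuting with the actions. $\mathcal{G}$-sheaves form an abelian category with enough injectives. $\underline{\mathbb{Z}}$ is the constant sheaf with fiber $\mathbb{Z}$ and trivial action. A resolution $\{\mathscr{Q}_n,\vartheta_n\}_{n\in\mathbb{N}}$ of $\underline{\mathbb{Z}}$ is an exact sequence of $\mathcal{G}$-sheaves $\cdots\to\mathscr{Q}_1\xrightarrow{\vartheta_1}\mathscr{Q}_0\xrightarrow{\vartheta_0}\underline{\mathbb{Z}}\to0$. When $n=1$, $\mathscr{Q}_{-1}$ is read as $\underline{\mathbb{Z}}$, so that the bottom row is $0\to\mathscr{A}\to\mathscr{R}_c\to\underline{\mathbb{Z}}\to0$.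 $Z^n_{\mathscr{Q}}(\mathcal{G},\mathscr{A})=\{c\in\operatorname{Hom}_{\mathcal{G}}(\mathscr{Q}_n,\mathscr{A}):c\circ\vartheta_{n+1}=0\}$, $B^n_{\mathscr{Q}}(\mathcal{G},\mathscr{A})=\{g\circ\vartheta_n:g\in\operatorname{Hom}_{\mathcal{G}}(\mathscr{Q}_{n-1},\mathscr{A})\}$ for $n\ge1$, $B^0_{\mathscr{Q}}(\mathcal{G},\mathscr{A})=0$, and $H^n_{\mathscr{Q}}(\mathcal{G},\mathscr{A})=Z^n_{\mathscr{Q}}(\mathcal{G},\mathscr{A})/B^n_{\mathscr{Q}}(\mathcal{G},\mathscr{A})$. $H^n(\mathcal{G},\cdot)$ is equivariant sheaf cohomology: the sequence of functors (unique up to natural equivalence) with $H^0(\mathcal{G},\cdot)\cong\operatorname{Hom}_{\mathcal{G}}(\underline{\mathbb{Z}},\cdot)$, vanishing on injectives for $n>0$, and having natural long exact sequences, i.e. the right derived functors of $\operatorname{Hom}_{\mathcal{G}}(\underline{\mathbb{Z}},\cdot)$. It is identified with Yoneda $\operatorname{Ext}^n_{\mathcal{G}}(\underline{\mathbb{Z}},\mathscr{A})$: for $n\ge1$, equivalence classes of $n$-fold exact sequences $0\to\mathscr{A}\to\mathscr{R}_{n-1}\to\cdots\to\mathscr{R}_0\to\underline{\mathbb{Z}}\to0$ of $\mathcal{G}$-sheaves, the equivalence relation being generated by morphisms of such sequences that are the identity on $\mathscr{A}$ and $\underline{\mathbb{Z}}$; for $n=0$, $\operatorname{Ext}^0_{\mathcal{G}}(\underline{\mathbb{Z}},\mathscr{A})=\operatorname{Hom}_{\mathcal{G}}(\underline{\mathbb{Z}},\mathscr{A})=H^0(\mathcal{G},\mathscr{A})$.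 *)

(* Defs.v *)
From HB Require Import structures.
From mathcomp Require Import all_boot all_order all_algebra ring_quotient.
From mathcomp Require Import all_classical topology.
From Stdlib Require Import Relations.

Set Implicit Arguments.
Unset Strict Implicit.
Unset Printing Implicit Defensive.

Import GRing.Theory.
Import Quotient.Exports.
Local Open Scope classical_set_scope.
Local Open Scope ring_scope.

Definition local_homeomorphism (S T : topologicalType) (f : S -> T) : Prop :=
  forall x : S, exists (U : set S) (V : set T) (g : T -> S),
    [/\ open U, open V & U x] /\
    [/\ {homo f : y / U y >-> V y}, {homo g : z / V z >-> U z},
        (forall y, U y -> g (f y) = y) & (forall z, V z -> f (g z) = z)] /\
    {within U, continuous f} /\ {within V, continuous g}.

(* The gunit space is a separate space [obj] rather than a subset of the space
   of arrows.  As [rng \o gunit] is the identity and both maps are continuous,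
   [gunit] is a homeomorphism onto its image with the subspace topology.  The
   product [gmul g h] is only meaningful when [src g = rng h]. *)
Record etale_groupoid : Type := EtaleGroupoid {
  arr :> topologicalType;
  obj : topologicalType;
  src : arr -> obj;
  rng : arr -> obj;
  gunit : obj -> arr;
  gmul : arr -> arr -> arr;
  ginv : arr -> arr;
  src_unit : forall x, src (gunit x) = x;
  rng_unit : forall x, rng (gunit x) = x;
  src_mul : forall g h, src g = rng h -> src (gmul g h) = src h;
  rng_mul : forall g h, src g = rng h -> rng (gmul g h) = rng g;
  mulA : forall g h k, src g = rng h -> src h = rng k ->
    gmul g (gmul h k) = gmul (gmul g h) k;
  mul_unitl : forall g, gmul (gunit (rng g)) g = g;
  mul_unitr : forall g, gmul g (gunit (src g)) = g;
  src_inv : forall g, src (ginv g) = rng g;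
  rng_inv : forall g, rng (ginv g) = src g;
  mulVl : forall g, gmul (ginv g) g = gunit (src g);
  mulVr : forall g, gmul g (ginv g) = gunit (rng g);
  unit_continuous : continuous gunit;
  inv_continuous : continuous ginv;
  mul_continuous : {within [set p : arr * arr | src p.1 = rng p.2],
    continuous (fun p => gmul p.1 p.2)};
  src_local_homeo : local_homeomorphism src;
  rng_local_homeo : local_homeomorphism rng;
  arr_hausdorff : hausdorff_space arr;
  arr_locally_compact : locally_compact [set: arr]
}.

(* The fibre over [x] is [proj @^-1` [set x]], with neutral element [fzero x].
   The total functions [fadd a b] and [act g a] are only meaningful when
   [proj a = proj b] and [src g = proj a] respectively; neither the axioms nor
   the morphisms depend on their other values.  The maps [act g] between fibres
   are isomorphisms, with inverses [act (ginv g)], by [act_unit] and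
   [act_mul]. *)
Record gsheaf (G : etale_groupoid) : Type := GSheaf {
  tot :> topologicalType;
  proj : tot -> obj G;
  fzero : obj G -> tot;
  fopp : tot -> tot;
  fadd : tot -> tot -> tot;
  act : G -> tot -> tot;
  proj_local_homeo : local_homeomorphism proj;
  proj_zero : forall x, proj (fzero x) = x;
  proj_opp : forall a, proj (fopp a) = proj a;
  proj_add : forall a b, proj a = proj b -> proj (fadd a b) = proj a;
  fib_addA : forall a b c, proj a = proj b -> proj b = proj c ->
    fadd a (fadd b c) = fadd (fadd a b) c;
  fib_addC : forall a b, proj a = proj b -> fadd a b = fadd b a;
  fib_add0 : forall a, fadd (fzero (proj a)) a = a;
  fib_addN : forall a, fadd (fopp a) a = fzero (proj a);
  zero_continuous : continuous fzero;
  opp_continuous : continuous fopp;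
  add_continuous : {within [set p : tot * tot | proj p.1 = proj p.2],
    continuous (fun p => fadd p.1 p.2)};
  proj_act : forall g a, src g = proj a -> proj (act g a) = rng g;
  act_add : forall g a b, src g = proj a -> proj a = proj b ->
    act g (fadd a b) = fadd (act g a) (act g b);
  act_unit : forall a, act (gunit (proj a)) a = a;
  act_mul : forall g h a, src g = rng h -> src h = proj a ->
    act (gmul g h) a = act g (act h a);
  act_continuous : {within [set p : G * tot | src p.1 = proj p.2],
    continuous (fun p => act p.1 p.2)}
}.

Arguments fzero {G} _ _.

Record ghom (G : etale_groupoid) (A B : gsheaf G) : Type := GHom {
  hom_fun :> A -> B;
  hom_continuous : continuous hom_fun;
  hom_proj : forall a, proj (hom_fun a) = proj a;
  hom_add : forall a b, proj a = proj b ->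
    hom_fun (fadd a b) = fadd (hom_fun a) (hom_fun b);
  hom_act : forall g a, src g = proj a -> hom_fun (act g a) = act g (hom_fun a)
}.

Section HomTheory.
Variable G : etale_groupoid.
Implicit Types A B C D : gsheaf G.

Lemma hom_ext A B (f g : ghom A B) : f =1 g -> f = g.
Proof.
case: f g => [f f1 f2 f3 f4] [g g1 g2 g3 g4] /= /funext fg; subst g.
by congr GHom; exact: Prop_irrelevance.
Qed.

Definition id_hom A : ghom A A.
Proof. by refine (@GHom G A A id _ _ _ _) => // x; exact: cvg_id. Defined.

Definition comp_hom A B C (g : ghom B C) (f : ghom A B) : ghom A C.
Proof.
refine (@GHom G A C (g \o f) _ _ _ _) => [a|a|a b ab|h a ha] /=.
- by apply: continuous_comp; exact: hom_continuous.
- by rewrite !hom_proj.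
- by rewrite !hom_add ?hom_proj.
- by rewrite !hom_act ?hom_proj.
Defined.

Lemma fib_add0r A (a : A) : fadd a (fzero A (proj a)) = a.
Proof. by rewrite fib_addC ?fib_add0 // proj_zero. Qed.

Lemma fib_addNr A (a : A) : fadd a (fopp a) = fzero A (proj a).
Proof. by rewrite fib_addC ?fib_addN // proj_opp. Qed.

Lemma fib_idem A (a : A) : fadd a a = a -> a = fzero A (proj a).
Proof.
by move=> aa; rewrite -(fib_addN a) -{3}aa fib_addA ?proj_opp // fib_addN fib_add0.
Qed.

Lemma fib_opp_uniq A (a b : A) : proj a = proj b ->
  fadd a b = fzero A (proj a) -> b = fopp a.
Proof.
move=> pab ab; rewrite -(fib_add0 b) -pab -(fib_addN a) -fib_addA ?proj_opp //.
by rewrite ab -(proj_opp a) fib_add0r.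
Qed.

Lemma act_zero A (g : G) : act g (fzero A (src g)) = fzero A (rng g).
Proof.
set z := fzero A _.
have pz : src g = proj z by rewrite proj_zero.
have zz : fadd z z = z by rewrite /z -{1}(proj_zero A (src g)) fib_add0.
rewrite -(proj_act pz); apply: fib_idem.
by rewrite -act_add // zz.
Qed.

Lemma act_opp A (g : G) (a : A) : src g = proj a -> act g (fopp a) = fopp (act g a).
Proof.
move=> ga; have ga' : src g = proj (fopp a) by rewrite proj_opp.
apply: fib_opp_uniq; first by rewrite !proj_act.
by rewrite -act_add ?proj_opp // fib_addNr -ga act_zero proj_act.
Qed.

Lemma add_hom_continuous A B (f g : ghom A B) :
  continuous (fun a => fadd (f a) (g a)).
Proof.
move=> a; set D := [set p : B * B | proj p.1 = proj p.2].
have Da x : D (f x, g x) by rewrite /D /= !hom_proj.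
have /subspace_continuousP/(_ _ (Da a)) addc := @add_continuous G B.
move=> U /addc; rewrite !nbhs_simpl /= => -[[P R] /= [nP nR] PR].
have fP : nbhs a (f @^-1` P) by exact: hom_continuous nP.
have gR : nbhs a (g @^-1` R) by exact: hom_continuous nR.
apply: filterS (filterI fP gR) => x [Px Rx].
exact: (PR (f x, g x) (conj Px Rx) (Da x)).
Qed.

Definition hom_addition A B (f g : ghom A B) : ghom A B.
Proof.
refine (@GHom G A B (fun a => fadd (f a) (g a)) _ _ _ _).
- exact: add_hom_continuous.
- by move=> a; rewrite proj_add !hom_proj.
- move=> a b ab; rewrite !hom_add //.
  have E (u v : ghom A B) x y : proj x = proj y -> proj (u x) = proj (v y).
    by rewrite !hom_proj.
  rewrite !fib_addA ?proj_add ?hom_proj //; congr fadd.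
  rewrite -!fib_addA ?hom_proj //; congr fadd.
  by rewrite fib_addC // !hom_proj.
- move=> h a ha; rewrite !hom_act // act_add ?hom_proj //.
Defined.

Definition hom_opposite A B (f : ghom A B) : ghom A B.
Proof.
refine (@GHom G A B (fun a => fopp (f a)) _ _ _ _).
- move=> a; apply: (@continuous_comp _ _ _ f (@fopp G B)).
    exact: hom_continuous.
  exact: opp_continuous.
- by move=> a; rewrite proj_opp hom_proj.
- move=> a b ab; rewrite hom_add //; set x := f a; set y := f b.
  have xy : proj x = proj y by rewrite !hom_proj.
  apply/esym/fib_opp_uniq; first by rewrite !proj_add ?proj_opp.
  rewrite (fib_addC xy) fib_addA ?proj_add ?proj_opp // -(fib_addA (a := y)) ?proj_opp //.
  rewrite fib_addNr xy fib_add0r fib_addNr //.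
- by move=> h a ha; rewrite hom_act // act_opp ?hom_proj.
Defined.

Definition hom_zero A B : ghom A B.
Proof.
refine (@GHom G A B (fun a => fzero B (proj a)) _ _ _ _).
- move=> a; apply: (@continuous_comp _ _ _ (@proj G A) (fzero B)).
    have [U [V [g [[oU _ Ua] [_ [fc _]]]]]] := @proj_local_homeo G A a.
    by move: fc; rewrite continuous_open_subspace // => /(_ a); apply; rewrite inE.
  exact: zero_continuous.
- by move=> a; rewrite proj_zero.
- move=> a b ab; rewrite proj_add // -ab.
  by rewrite -{2}(proj_zero B (proj a)) fib_add0.
- by move=> h a ha; rewrite proj_act // -ha act_zero.
Defined.

HB.instance Definition _ A B := gen_eqMixin (ghom A B).
HB.instance Definition _ A B := gen_choiceMixin (ghom A B).

Fact hom_addrA A B : associative (@hom_addition A B).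
Proof. by move=> f g h; apply: hom_ext => a /=; rewrite fib_addA ?hom_proj. Qed.

Fact hom_addrC A B : commutative (@hom_addition A B).
Proof. by move=> f g; apply: hom_ext => a /=; rewrite fib_addC ?hom_proj. Qed.

Fact hom_add0r A B : left_id (hom_zero A B) (@hom_addition A B).
Proof.
by move=> f; apply: hom_ext => a /=; rewrite -(hom_proj f) fib_add0.
Qed.

Fact hom_addNr A B :
  left_inverse (hom_zero A B) (@hom_opposite A B) (@hom_addition A B).
Proof. by move=> f; apply: hom_ext => a /=; rewrite fib_addN hom_proj. Qed.

HB.instance Definition _ A B := GRing.isZmodule.Build (ghom A B)
  (@hom_addrA A B) (@hom_addrC A B) (@hom_add0r A B) (@hom_addNr A B).

Lemma comp_homBl A B C (g h : ghom B C) (f : ghom A B) :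
  comp_hom (g - h) f = comp_hom g f - comp_hom h f.
Proof. by apply: hom_ext. Qed.

Lemma comp_hom0l A B C (f : ghom A B) : comp_hom (0 : ghom B C) f = 0.
Proof. by apply: hom_ext => a; rewrite /= hom_proj. Qed.

End HomTheory.

Arguments id_hom {G} A.
Arguments hom_zero {G} A B.

Section ConstantSheaf.
Variable G : etale_groupoid.

Let Z : topologicalType := discrete_topology int.
Let T : topologicalType := (obj G * Z)%type.

Let cadd (a b : T) : T := (a.1, (a.2 : int) + (b.2 : int)).
Let copp (a : T) : T := (a.1, - (a.2 : int)).
Let czero (x : obj G) : T := (x, 0 : int).
Let cact (g : G) (a : T) : T := (rng g, a.2).

Let continuous_to_Z (S : topologicalType) (f : S -> Z) :
  (forall x, nbhs x [set y | f y = f x]) -> continuous f.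
Proof.
move=> fx x; apply/(@discrete_cvg (discrete_topology int)); exact: fx.
Qed.

Let nbhs_Z (S : topologicalType) (f : S -> Z) (x : S) :
  {for x, continuous f} -> nbhs x [set y | f y = f x].
Proof. by move=> /(_ [set f x]); apply; exact: (@discrete_set1 (discrete_topology int)). Qed.

Let fst_cont (S1 S2 : topologicalType) : continuous (fst : S1 * S2 -> S1).
Proof. by move=> x; exact: cvg_fst. Qed.
Let snd_cont (S1 S2 : topologicalType) : continuous (snd : S1 * S2 -> S2).
Proof. by move=> x; exact: cvg_snd. Qed.

Let pair_cont (S1 S2 S3 : topologicalType) (f : S1 -> S2) (g : S1 -> S3) :
  continuous f -> continuous g -> continuous (fun x => (f x, g x)).
Proof. by move=> fc gc x; apply: cvg_pair; [exact: fc|exact: gc]. Qed.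

Let cst_cont (k : Z) (S : topologicalType) : continuous (fun _ : S => k).
Proof. by move=> x; exact: cvg_cst. Qed.

Let id_cont (S : topologicalType) : continuous (fun x : S => x).
Proof. by move=> x; exact: cvg_id. Qed.

Let cproj_local_homeo : local_homeomorphism (fst : T -> obj G).
Proof.
move=> [x k]; exists [set a : T | a.2 = k], setT, (fun y => (y, k) : T).
split; first split => //.
- rewrite openE => a /= ak; rewrite /interior /= -ak.
  by apply: nbhs_Z; exact: snd_cont.
- exact: openT.
split; first by split => //= -[y l] /= ->.
split; apply: continuous_subspaceT; first exact: fst_cont.
exact: (@pair_cont (obj G) (obj G) Z id (fun=> k)).
Qed.

Let czero_continuous : continuous czero.
Proof. exact: (@pair_cont (obj G) (obj G) Z id (fun=> 0 : int)). Qed.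

Let copp_continuous : continuous copp.
Proof.
apply: (@pair_cont T (obj G) Z fst (fun a : T => - (a.2 : int))).
  exact: fst_cont.
apply: (@continuous_to_Z T (fun a : T => - (a.2 : int))) => b.
by apply: filterS (nbhs_Z (@snd_cont _ _ b)) => c /= ->.
Qed.

Let cadd_continuous : continuous (fun p : T * T => cadd p.1 p.2).
Proof.
apply: (@pair_cont (T * T)%type (obj G) Z (fun p : T * T => p.1.1)
  (fun p : T * T => (p.1.2 : int) + (p.2.2 : int))).
  by move=> a; apply: (@continuous_comp _ _ _ fst fst); exact: fst_cont.
apply: (@continuous_to_Z (T * T)%type
  (fun p : T * T => (p.1.2 : int) + (p.2.2 : int))) => b.
have h1 : {for b, continuous (fun p : T * T => p.1.2)}.
  by apply: (@continuous_comp _ _ _ fst snd); [exact: fst_cont|exact: snd_cont].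
have h2 : {for b, continuous (fun p : T * T => p.2.2)}.
  by apply: (@continuous_comp _ _ _ snd snd); exact: snd_cont.
by apply: filterS (filterI (nbhs_Z h1) (nbhs_Z h2)) => c /= [-> ->].
Qed.

Let rng_continuous : continuous (@rng G).
Proof.
move=> a; have [U [V [g [[oU _ Ua] [_ [fc _]]]]]] := @rng_local_homeo G a.
by move: fc; rewrite continuous_open_subspace // => /(_ a); apply; rewrite inE.
Qed.

Let cact_continuous : continuous (fun p : G * T => cact p.1 p.2).
Proof.
apply: (@pair_cont (G * T)%type (obj G) Z (fun p : G * T => rng p.1)
  (fun p : G * T => p.2.2)) => a.
  apply: (@continuous_comp _ _ _ fst (@rng G)); first exact: fst_cont.
  exact: rng_continuous.
by apply: (@continuous_comp _ _ _ snd snd); exact: snd_cont.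
Qed.

Definition const_Z : gsheaf G.
Proof.
refine (@GSheaf G T fst czero copp cadd cact
  cproj_local_homeo _ _ _ _ _ _ _
  czero_continuous copp_continuous (continuous_subspaceT cadd_continuous)
  _ _ _ _ (continuous_subspaceT cact_continuous)).
- by [].
- by [].
- by [].
- by move=> a b c _ _; rewrite /cadd /= addrA.
- by move=> a b ab; rewrite /cadd ab addrC.
- by move=> [x k]; rewrite /cadd /= add0r.
- by move=> [x k]; rewrite /cadd /czero /= addNr.
- by [].
- by [].
- by move=> [x k]; rewrite /cact /= rng_unit.
- by move=> g h a gh _; rewrite /cact /= rng_mul.
Defined.

End ConstantSheaf.

Section Exactness.
Variable G : etale_groupoid.
Implicit Types A B C : gsheaf G.

Definition hom_ker A B (f : ghom A B) : set A :=
  [set a | f a = fzero B (proj a)].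

Definition short_exact A B C (f : ghom A B) (g : ghom B C) : Prop :=
  [/\ injective f, range f = hom_ker g & range g = setT].

(* Monomorphisms of sheaves are the injective morphisms. *)
Definition injective_sheaf (J : gsheaf G) : Prop :=
  forall A B (i : ghom A B) (f : ghom A J), injective i ->
    exists g : ghom B J, comp_hom g i = f.

End Exactness.

Section Sequences.
Variable G : etale_groupoid.

(* [aug_target P n] is P_{n-1}, with P_{-1} the constant sheaf, so that
   [aug_bd X n] is the n-th map of ... -> P_1 -> P_0 -> Z. *)
Definition aug_target (P : nat -> gsheaf G) (n : nat) : gsheaf G :=
  if n is k.+1 then P k else const_Z G.

Record aug_sequence : Type := AugSequence {
  aug_obj :> nat -> gsheaf G;
  aug_bd : forall n, ghom (aug_obj n) (aug_target aug_obj n)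
}.

(* The kernel of the map leaving P_{n-1}; all of Z for n = 0, as Z -> 0. *)
Definition aug_cycles (X : aug_sequence) (n : nat) : set (aug_target X n) :=
  match n return set (aug_target X n) with
  | 0 => setT
  | k.+1 => hom_ker (aug_bd X k)
  end.
Arguments aug_cycles : clear implicits.

Record resolution : Type := Resolution {
  res_seq :> aug_sequence;
  res_exact : forall n, range (aug_bd res_seq n) = aug_cycles res_seq n
}.

(* Exactness of 0 -> A -> R -> P_{m-1} -> ... -> P_0 -> Z -> 0, with the sheaf
   R in place of P_m; the terms P_k of X with k >= m play no role. *)
Definition nfold_exact (A : gsheaf G) (m : nat) (X : aug_sequence)
    (R : gsheaf G) (i : ghom A R) (d : ghom R (aug_target X m)) : Prop :=
  [/\ injective i, range i = hom_ker d, range d = aug_cycles X m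
    & forall k, (k < m)%N -> range (aug_bd X k) = aug_cycles X k].

(* An (m+1)-fold exact sequence from A to Z, with R_m = [nf_top] and
   R_k = [nf_low k] for k < m; the terms of [nf_low] of index at least m are
   irrelevant, and are ignored by [nfold_map]. *)
Record nfold (A : gsheaf G) (m : nat) : Type := NFold {
  nf_low : aug_sequence;
  nf_top : gsheaf G;
  nf_inj : ghom A nf_top;
  nf_bd : ghom nf_top (aug_target nf_low m);
  nf_exact : nfold_exact nf_inj nf_bd
}.

Definition aug_target_map (X Y : aug_sequence) (f : forall k, ghom (X k) (Y k))
    (n : nat) : ghom (aug_target X n) (aug_target Y n) :=
  match n return ghom (aug_target X n) (aug_target Y n) with
  | 0 => id_hom (const_Z G)
  | k.+1 => f k
  end.

Definition nfold_map (A : gsheaf G) (m : nat) (E F : nfold A m) : Prop :=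
  exists (f : forall k, ghom (nf_low E k) (nf_low F k))
         (g : ghom (nf_top E) (nf_top F)),
  [/\ comp_hom g (nf_inj E) = nf_inj F,
      comp_hom (nf_bd F) g = comp_hom (aug_target_map f m) (nf_bd E)
    & forall k, (k < m)%N ->
        comp_hom (aug_bd (nf_low F) k) (f k) =
        comp_hom (aug_target_map f k) (aug_bd (nf_low E) k)].

Definition nfold_equiv (A : gsheaf G) (m : nat) : nfold A m -> nfold A m -> Prop :=
  clos_refl_sym_trans (nfold A m) (@nfold_map A m).

(* Ext^{m+1}(Z, A), as the set of equivalence classes. *)
Definition Ext (A : gsheaf G) (m : nat) : Type :=
  {C : nfold A m -> Prop | exists E, C = nfold_equiv E}.

Definition ext_class (A : gsheaf G) (m : nat) (E : nfold A m) : Ext A m :=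
  exist _ (nfold_equiv E) (ex_intro _ E erefl).

End Sequences.

Section ResolutionCohomology.
Variables (G : etale_groupoid) (Q : resolution G) (A : gsheaf G) (n : nat).

Definition cocycle_pred : {pred ghom (Q n) A} :=
  fun c => comp_hom c (aug_bd Q n.+1) == 0.

Fact cocycle_zmod_closed : zmod_closed cocycle_pred.
Proof.
split=> [|c d]; rewrite !unfold_in; first by apply/eqP; exact: comp_hom0l.
move=> /eqP c0 /eqP d0; apply/eqP.
by rewrite (@comp_homBl _ _ (Q n)) c0 d0 subrr.
Qed.

HB.instance Definition _ :=
  GRing.isZmodClosed.Build (ghom (Q n) A) cocycle_pred cocycle_zmod_closed.

Definition cocycle : Type := {c : ghom (Q n) A | c \in cocycle_pred}.
HB.instance Definition _ := Choice.on cocycle.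
HB.instance Definition _ := SubType.on cocycle.
HB.instance Definition _ := [SubChoice_isSubZmodule of cocycle by <:].

Definition cocycle_hom (c : cocycle) : ghom (Q n) A := val c.

End ResolutionCohomology.

Coercion cocycle_hom : cocycle >-> ghom.

Section ResolutionCohomologyQuotient.
Variables (G : etale_groupoid) (Q : resolution G) (A : gsheaf G).

Definition coboundary (n : nat) : ghom (Q n) A -> Prop :=
  match n return ghom (Q n) A -> Prop with
  | 0 => fun c => c = 0
  | k.+1 => fun c => exists g : ghom (Q k) A, c = comp_hom g (aug_bd Q k.+1)
  end.

Definition coboundary_pred (n : nat) : {pred cocycle Q A n} :=
  fun c => `[< coboundary (cocycle_hom c) >].

Lemma cocycle_homB n (c d : cocycle Q A n) :
  cocycle_hom (c - d) = cocycle_hom c - cocycle_hom d.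
Proof. by []. Qed.

Fact coboundary_zmod_closed n : zmod_closed (@coboundary_pred n).
Proof.
case: n => [|n]; split=> [|c d]; rewrite !unfold_in.
- exact/asboolP.
- by move=> /asboolP /= c0 /asboolP /= d0; apply/asboolP; rewrite /= cocycle_homB c0 d0 subrr.
- by apply/asboolP; exists 0; rewrite (@comp_hom0l _ _ (Q n)).
- move=> /asboolP [g cg] /asboolP [h dh]; apply/asboolP; exists (g - h).
  by rewrite (@comp_homBl _ _ (Q n)) cocycle_homB cg dh.
Qed.

HB.instance Definition _ n := GRing.isZmodClosed.Build (cocycle Q A n)
  (@coboundary_pred n) (@coboundary_zmod_closed n).

Definition resolution_cohomology (n : nat) : zmodType :=
  Quotient.quot (@coboundary_pred n).

Definition coh_class (n : nat) (c : cocycle Q A n) : resolution_cohomology n :=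
  (\pi_(Quotient.quot (@coboundary_pred n)) c)%qT.

End ResolutionCohomologyQuotient.

(* A cohomological delta-functor extending Hom_G(Z, -) and vanishing on
   injectives in positive degree; this characterizes H^n(G, -) up to unique
   natural isomorphism. *)
Record sheaf_cohomology (G : etale_groupoid) : Type := SheafCohomology {
  coh :> nat -> gsheaf G -> zmodType;
  coh_map : forall n (A B : gsheaf G), ghom A B -> {additive coh n A -> coh n B};
  coh_map_id : forall n A (x : coh n A), coh_map n (id_hom A) x = x;
  coh_map_comp : forall n A B C (f : ghom A B) (g : ghom B C) (x : coh n A),
    coh_map n (comp_hom g f) x = coh_map n g (coh_map n f x);
  coh_hom : forall A, {additive ghom (const_Z G) A -> coh 0 A};
  coh_hom_bij : forall A, bijective (coh_hom A);
  coh_hom_nat : forall A B (f : ghom A B) (u : ghom (const_Z G) A),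
    coh_map 0 f (coh_hom A u) = coh_hom B (comp_hom f u);
  coh_injective : forall n J, injective_sheaf J -> (0 < n)%N ->
    forall x : coh n J, x = 0;
  coh_delta : forall n A B C (f : ghom A B) (g : ghom B C),
    short_exact f g -> {additive coh n C -> coh n.+1 A};
  coh_delta_nat : forall n A B C (f : ghom A B) (g : ghom B C)
      (fg : short_exact f g) A' B' C' (f' : ghom A' B') (g' : ghom B' C')
      (fg' : short_exact f' g') (a : ghom A A') (b : ghom B B') (c : ghom C C'),
    comp_hom b f = comp_hom f' a -> comp_hom c g = comp_hom g' b ->
    forall x : coh n C,
      coh_map n.+1 a (coh_delta n fg x) = coh_delta n fg' (coh_map n c x);
  coh_exact0 : forall A B C (f : ghom A B) (g : ghom B C), short_exact f g ->
    injective (coh_map 0 f);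
  coh_exact_mid : forall n A B C (f : ghom A B) (g : ghom B C),
    short_exact f g ->
    range (coh_map n f) = [set y : coh n B | coh_map n g y = 0];
  coh_exact_right : forall n A B C (f : ghom A B) (g : ghom B C)
      (fg : short_exact f g),
    range (coh_map n g) = [set z : coh n C | coh_delta n fg z = 0];
  coh_exact_left : forall n A B C (f : ghom A B) (g : ghom B C)
      (fg : short_exact f g),
    range (coh_delta n fg) = [set x : coh n.+1 A | coh_map n.+1 f x = 0]
}.

Section YonedaIdentification.
Variables (G : etale_groupoid) (H : sheaf_cohomology G).

(* An exact sequence P_{n-1} -> ... -> P_0 -> Z -> 0 with kernel i : K -> P_{n-1}
   splits into short exact sequences 0 -> K_{j+1} -> P_j -> K_j -> 0 with
   K_0 = Z and K_n = K.  [iterated_delta n i x] says that x in H^n(K) is the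
   image of id_Z in H^0(Z) under the composite of their n connecting maps. *)
Inductive iterated_delta (X : aug_sequence G) : forall (n : nat) (K : gsheaf G),
    ghom K (aug_target X n) -> H n K -> Prop :=
| Iterated_delta0 :
    iterated_delta (n := 0) (id_hom (const_Z G))
      (coh_hom H (const_Z G) (id_hom (const_Z G)))
| Iterated_deltaS n K (i : ghom K (aug_target X n)) (x : H n K)
    K' (i' : ghom K' (X n)) (p : ghom (X n) K) (e : short_exact i' p) :
    iterated_delta i x -> comp_hom i p = aug_bd X n ->
    iterated_delta (n := n.+1) i' (coh_delta H n e x).

Definition nfold_value (A : gsheaf G) (m : nat) (E : nfold A m) (y : H m.+1 A) :
    Prop :=
  exists (K : gsheaf G) (i : ghom K (aug_target (nf_low E) m)) (x : H m K)
      (p : ghom (nf_top E) K) (e : short_exact (nf_inj E) p),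
    [/\ iterated_delta i x, comp_hom i p = nf_bd E & y = coh_delta H m e x].

(* The graph of the identification of Ext^{m+1}(Z, A) with H^{m+1}(G, A). *)
Definition Ext_coh (A : gsheaf G) (m : nat) (a : Ext A m) (y : H m.+1 A) : Prop :=
  exists E : nfold A m, a = ext_class E /\ nfold_value E y.

End YonedaIdentification.

(* The diagram for c in Z^{m+1}: the right-hand vertical maps are identities
   because the bottom row ends with the terms Q_{m-1}, ..., Q_0 of Q itself.
   The last field is the square through Q_{m+2} -> 0. *)
Record cocycle_diagram (G : etale_groupoid) (Q : resolution G) (A : gsheaf G)
    (m : nat) (c : ghom (Q m.+1) A) : Type := CocycleDiagram {
  cd_top : gsheaf G;
  cd_inj : ghom A cd_top;
  cd_bd : ghom cd_top (aug_target Q m);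
  cd_exact : nfold_exact cd_inj cd_bd;
  cd_vert : ghom (Q m) cd_top;
  cd_square_c : comp_hom cd_inj c = comp_hom cd_vert (aug_bd Q m.+1);
  cd_square_id : comp_hom cd_bd cd_vert = aug_bd Q m;
  cd_square_0 : comp_hom c (aug_bd Q m.+2) = 0
}.

Definition bottom_row (G : etale_groupoid) (Q : resolution G) (A : gsheaf G)
    (m : nat) (c : ghom (Q m.+1) A) (D : cocycle_diagram c) : nfold A m :=
  NFold (cd_exact D).

(* Main.v *)
Require Import Defs.
From HB Require Import structures.
From Stdlib Require Import Relations.
From mathcomp Require Import all_boot all_algebra.
From mathcomp Require Import all_classical topology.

Set Implicit Arguments.
Unset Strict Implicit.
Unset Printing Implicit Defensive.

(* [topology] exports another [proj]; this restores the one of [gsheaf]. *)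
Import Defs GRing.Theory.
Local Open Scope classical_set_scope.
Local Open Scope quotient_scope.
Local Open Scope ring_scope.

(** The sheaf R_c is the pushout of c and theta_n, that is the cokernel of
    (c, -theta_n) : Q_n -> A + Q_{n-1}.  In any diagram for c the sheaf R is
    covered by A + Q_{n-1}, so for c' = c - g o theta_n the map
    (a, q) |-> (a, q + g q) descends to a morphism of n-fold extensions.

    Let K_j be the kernel of the map leaving Q_{j-1} and x_j in H^j(K_j) the
    iterated connecting image of id_Z.  A cocycle c induces cbar : K_n -> A,
    and naturality of the connecting map, applied to the morphism from
    0 -> K_n -> Q_{n-1} -> K_{n-1} -> 0 to 0 -> A -> R -> K_{n-1} -> 0, shows that
    every bottom row for c has value cbar_* x_n.  Hence rho [c] = cbar_* x_n. *)

(** * Local homeomorphisms and sheaf morphisms *)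

Section Topology.
Implicit Types S T : topologicalType.

(** For the converse, openness of [f] makes the inverse of an injective restriction continuous. The
    right-hand side is what gets checked for kernels, direct sums and cokernels, where explicit
    local inverses would be awkward. *)
Lemma local_homeomorphismP S T (f : S -> T) :
  local_homeomorphism f <->
  [/\ continuous f, forall U, open U -> open (f @` U) &
    forall x, exists U, [/\ open U, U x & {in U &, injective f}]].
Proof.
split=> [lhf|[fc fo fi] x].
  split=> [x|W oW|x].
  - have [U [V [g [[oU _ Ux] [_ [Uf _]]]]]] := lhf x.
    by move: Uf; rewrite continuous_open_subspace // => Uf; apply: Uf; rewrite inE.
  - rewrite openE => _ [x Wx <-].
    have [U [V [g [[oU oV Ux] [[fUV gVU gK fK] [_ Vg]]]]]] := lhf x.
    have Vfx : V (f x) by exact: fUV.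
    move: Vg; rewrite continuous_open_subspace // => /(_ (f x)).
    rewrite inE => /(_ Vfx W); rewrite /= gK // => /(_ (open_nbhs_nbhs (conj oW Wx))) gW.
    have {}gW : nbhs (f x) (g @^-1` W) by exact: gW.
    apply: filterS (filterI gW (open_nbhs_nbhs (conj oV Vfx))) => z [/= Wgz Vz].
    by exists (g z) => //; exact: fK.
  - have [U [V [g [[oU _ Ux] [[_ _ gK _] _]]]]] := lhf x.
    exists U; split => // y z; rewrite !inE => Uy Uz fyz.
    by rewrite -(gK y Uy) fyz gK.
have [U [oU Ux injU]] := fi x.
(* The local inverse has to be total: off the image of [U] it takes the dummy value [x]. *)
have /choice[g gP] z : exists y, (f @` U) z -> U y /\ f y = z.
  have [[y Uy <-]|nz] := pselect ((f @` U) z); first by exists y.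
  by exists x => /nz.
exists U, (f @` U), g; split; first by split=> //; exact: fo.
split.
  split=> [y Uy|z /gP[]//|y Uy|z /gP[]//]; first by exists y.
  have [|Ugy fgy] := gP (f y); first by exists y.
  by apply: injU; rewrite ?inE.
split; first exact: continuous_subspaceT.
rewrite continuous_open_subspace; last exact: fo.
move=> z; rewrite inE => fUz W; rewrite nbhs_simpl /= nbhsE => -[W' [oW' W'z] W'W].
have [Ugz fgz] := gP z fUz.
rewrite /nbhs /=; apply: filterS (open_nbhs_nbhs (conj (fo _ (openI oU oW')) _)).
  move=> _ [y [Uy W'y] <-] /=; apply: W'W.
  have [|Ugy fgy] := gP (f y); first by exists y.
  by rewrite (injU (g (f y)) y) ?inE.
by exists (g z).
Qed.

(** Addition and action are continuous only on a subspace of a product; separate neighbourhoods of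
    the two factors are easy to transport to subsheaves and quotients. *)
Lemma within_prodP S1 S2 T (D : set (S1 * S2)) (f : S1 * S2 -> T) :
  {within D, continuous f} <->
  forall a b, D (a, b) -> forall W, nbhs (f (a, b)) W ->
    exists P R, [/\ nbhs a P, nbhs b R &
      forall x y, P x -> R y -> D (x, y) -> W (f (x, y))].
Proof.
split=> [/subspace_continuousP cf a b Dab W /(cf _ Dab)|H].
  rewrite nbhs_simpl /= => -[[P R] /= [nP nR] PR]; exists P, R; split=> // x y Px Ry.
  exact: (PR (x, y)).
apply/subspace_continuousP => -[a b] Dab W /(H _ _ Dab)[P [R [nP nR PR]]].
rewrite nbhs_simpl /=; exists (P, R) => //= -[x y] /= [Px Ry] Dxy.
exact: PR.
Qed.

Lemma val_set_continuous S (X : set S) : continuous (val : set_type X -> S).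
Proof. by move=> u; have := @initial_continuous _ _ (@set_val S X) u. Qed.

Lemma nbhs_set_type S (X : set S) (u : set_type X) (W : set (set_type X)) :
  nbhs u W <-> exists2 P : set S, nbhs (val u) P & forall v, P (val v) -> W v.
Proof.
split=> [[_ [[P oP <-] /= Pu] PW]|[P nP PW]].
  exists P; first exact: open_nbhs_nbhs.
  by move=> v Pv; apply: PW.
have nP' : nbhs u (val @^-1` P) := val_set_continuous nP.
by apply: filterS nP' => v; exact: PW.
Qed.

Lemma continuous_set_type S T (X : set S) (f : T -> set_type X) :
  continuous (val \o f) -> continuous f.
Proof.
move=> cf x W /nbhs_set_type[P nP PW]; have {}cf : nbhs x ((val \o f) @^-1` P) := cf x P nP.
by rewrite nbhs_simpl /=; apply: filterS cf => y; exact: PW.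
Qed.

End Topology.

Lemma insubd_val (T : eqType) (X : set T) (u : set_type X) x :
  X x -> val (insubd u x) = x.
Proof. by move=> Xx; apply: insubdK; rewrite inE. Qed.

(** * Openness, fibrewise algebra and factorization of sheaf morphisms *)

Section Homs.
Variable G : etale_groupoid.
Implicit Types A B C : gsheaf G.

Lemma proj_continuous A : continuous (@proj G A).
Proof. by have /local_homeomorphismP[] := @proj_local_homeo G A. Qed.

Lemma proj_open A (U : set A) : open U -> open (@proj G A @` U).
Proof. by have /local_homeomorphismP[_ + _] := @proj_local_homeo G A; apply. Qed.

Lemma proj_loc_inj A (a : A) :
  exists U : set A, [/\ open U, U a & {in U &, injective (@proj G A)}].
Proof. by have /local_homeomorphismP[_ _] := @proj_local_homeo G A; apply. Qed.

(** Near [f a] the projection of [B] is injective on some open [V]. A point of [V] lying over the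
    projection of [U] cut down to the preimage of [V] must therefore be a value of [f], and such
    points form an open set. *)
Lemma hom_open A B (f : ghom A B) (U : set A) : open U -> open (f @` U).
Proof.
move=> oU; rewrite openE => _ [a Ua <-].
have [V [oV Va injV]] := proj_loc_inj (f a).
have oU' : open (U `&` f @^-1` V).
  by apply: openI => //; move/continuousP: (@hom_continuous G _ _ f); exact.
have oW : open (V `&` @proj G B @^-1` (@proj G A @` (U `&` f @^-1` V))).
  apply: openI => //; move/continuousP: (@proj_continuous B); apply.
  exact: proj_open.
apply: filterS (open_nbhs_nbhs (conj oW _)); last by split=> //; exists a; rewrite ?hom_proj.
move=> b [Vb [a' [Ua' Vfa'] pa'b]]; exists a' => //.
by apply: injV; rewrite ?inE // hom_proj.
Qed.

Lemma fib_add00 A x : fadd (fzero A x) (fzero A x) = fzero A x.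
Proof. by rewrite -{1}(proj_zero A x) fib_add0. Qed.

Lemma hom_fzero A B (f : ghom A B) x : f (fzero A x) = fzero B x.
Proof.
rewrite -{2}(proj_zero A x) -(hom_proj f); apply: fib_idem.
by rewrite -hom_add ?fib_add00.
Qed.

Lemma hom_fopp A B (f : ghom A B) a : f (fopp a) = fopp (f a).
Proof.
apply: fib_opp_uniq; rewrite ?hom_proj ?proj_opp //.
by rewrite -hom_add ?proj_opp // fib_addNr hom_fzero.
Qed.

Lemma fib_subr0 A (a b : A) : proj a = proj b ->
  fadd a (fopp b) = fzero A (proj a) -> a = b.
Proof.
move=> ab E; rewrite -[LHS]fib_add0r ab -(fib_addN b) fib_addA ?proj_opp //.
by rewrite E ab fib_add0.
Qed.

Lemma fib_addACA A (a b c d : A) :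
  proj a = proj b -> proj b = proj c -> proj c = proj d ->
  fadd (fadd a b) (fadd c d) = fadd (fadd a c) (fadd b d).
Proof.
move=> ab bc cd; rewrite -!fib_addA ?proj_add ?ab ?bc ?cd //.
by rewrite (fib_addA bc cd) (fib_addC bc) -fib_addA ?bc.
Qed.

Lemma fib_oppK A (a : A) : fopp (fopp a) = a.
Proof. by apply/esym/fib_opp_uniq; rewrite ?proj_opp // fib_addN. Qed.

Lemma fib_addrNK A (a b : A) : proj a = proj b -> fadd (fadd a (fopp b)) b = a.
Proof. by move=> ab; rewrite -fib_addA ?proj_opp // fib_addN -ab fib_add0r. Qed.

Lemma hom_injective A B (f : ghom A B) :
  (forall a, hom_ker f a -> a = fzero A (proj a)) -> injective f.
Proof.
move=> kf a b fab.
have pab : proj a = proj b by rewrite -(hom_proj f) fab hom_proj.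
have pE : proj (fadd a (fopp b)) = proj a by rewrite proj_add ?proj_opp.
apply: fib_subr0 => //; rewrite -pE; apply: kf.
by rewrite /hom_ker /= pE hom_add ?proj_opp // hom_fopp fab fib_addNr hom_proj pab.
Qed.

(* A surjective morphism is open, hence a topological quotient map. *)
Lemma hom_factor_surj A B C (p : ghom A B) (f : ghom A C) :
  range p = setT -> hom_ker p `<=` hom_ker f -> exists g : ghom B C, comp_hom g p = f.
Proof.
move=> sp kpf.
(* A set-theoretic section of [p], with no continuity; by [fE] below, [f \o s] does not depend on
   it. *)
have /choice[s sK] b : exists a, p a = b.
  by have : range p b by [rewrite sp]; case=> a _ <-; exists a.
have ps b : proj (s b) = proj b by rewrite -{2}(sK b) hom_proj.
have fE a b : p a = p b -> f a = f b.
  move=> pab.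
  have Pab : proj a = proj b by rewrite -(hom_proj p) pab hom_proj.
  have pE : proj (fadd a (fopp b)) = proj a by rewrite proj_add ?proj_opp.
  apply: fib_subr0; rewrite ?hom_proj // -hom_fopp -hom_add ?proj_opp //.
  rewrite -pE; apply: kpf.
  by rewrite /hom_ker /= pE hom_add ?proj_opp // hom_fopp pab fib_addNr hom_proj Pab.
have fs a : f (s (p a)) = f a by apply: fE; rewrite sK.
unshelve eexists.
  refine (@GHom G B C (f \o s) _ _ _ _) => [|b|a b ab|h b hb] /=.
  - apply/continuousP => U oU.
    (* Continuity comes from this description of the preimage, since [p] is open. *)
    suff -> : (f \o s) @^-1` U = p @` (f @^-1` U).
      by apply: hom_open; move/continuousP: (@hom_continuous G _ _ f); exact.
    rewrite eqEsubset; split=> [b Ub|_ [a Ua <-]]; first by exists (s b) => //; rewrite sK.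
    by rewrite /preimage /= fs.
  - by rewrite hom_proj.
  - by rewrite -hom_add ?ps //; apply: fE; rewrite sK hom_add ?ps // !sK.
  - by rewrite -hom_act ?ps //; apply: fE; rewrite sK hom_act ?ps // !sK.
by apply: hom_ext => a /=.
Qed.

(** The pointwise lift is continuous because [i] is open: the preimage of [U] under the lift is the
    preimage of the image of [U] under [f]. *)
Lemma hom_factor_inj A B C (i : ghom A B) (f : ghom C B) :
  injective i -> range f `<=` range i -> exists g : ghom C A, comp_hom i g = f.
Proof.
move=> ii fi.
have /choice[g gP] c : exists a, i a = f c.
  by have [|a _ <-] := fi (f c); [exists c | exists a].
have pg c : proj (g c) = proj c by rewrite -(hom_proj i) gP hom_proj.
unshelve eexists.
  refine (@GHom G C A g _ pg _ _) => [|a b ab|h b hb] /=.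
  - apply/continuousP => U oU.
    suff -> : g @^-1` U = f @^-1` (i @` U).
      by move/continuousP: (@hom_continuous G _ _ f); apply; exact: hom_open.
    rewrite eqEsubset; split=> [c Uc|c [a Ua iac]]; first by exists (g c).
    by rewrite /preimage /= -(ii a (g c)) // gP.
  - by apply: ii; rewrite gP hom_add // hom_add ?pg // !gP.
  - by apply: ii; rewrite gP hom_act // hom_act ?pg // !gP.
by apply: hom_ext => a /=.
Qed.

End Homs.

(** * Kernels and biproducts *)

Section Kernel.
Variables (G : etale_groupoid) (A B : gsheaf G) (f : ghom A B).

(** The zero section of [B] is open, being the image of the zero endomorphism, and the kernel is its
    preimage. Hence the projection of [A] stays open when restricted to the kernel. *)
Lemma hom_ker_open : open (hom_ker f).
Proof.
have -> : hom_ker f = f @^-1` (hom_zero B B @` setT).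
  rewrite eqEsubset; split=> [a fa|a [b _ /= fa]].
    by exists (f a) => //=; rewrite hom_proj.
  by rewrite /hom_ker /= -fa -(hom_proj f) -fa proj_zero.
move/continuousP: (@hom_continuous G _ _ f); apply.
exact: hom_open openT.
Qed.

Let T : topologicalType := set_type (hom_ker f).

Let ker0 x : hom_ker f (fzero A x).
Proof. by rewrite /hom_ker /= hom_fzero proj_zero. Qed.

Let kerN a : hom_ker f a -> hom_ker f (fopp a).
Proof.
rewrite /hom_ker /= hom_fopp proj_opp => ->.
by apply/esym/fib_opp_uniq; rewrite // fib_add00 proj_zero.
Qed.

Let kerD a b : proj a = proj b -> hom_ker f a -> hom_ker f b -> hom_ker f (fadd a b).
Proof.
move=> ab; rewrite /hom_ker /= => fa fb; rewrite hom_add // fa fb proj_add // -ab.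
exact: fib_add00.
Qed.

Let kerJ g a : src g = proj a -> hom_ker f a -> hom_ker f (act g a).
Proof.
by move=> ga; rewrite /hom_ker /= hom_act // proj_act // => ->; rewrite -ga act_zero.
Qed.

Let kproj (u : T) := proj (val u).
Let kzero x : T := SigSub (mem_set (ker0 x)).
Let kopp (u : T) : T := SigSub (mem_set (kerN (set_valP u))).
(** For points of different fibres the sum need not lie in the kernel; [insubd] then returns the
    default [u]. The same device serves for [kact]. *)
Let kadd (u v : T) : T := insubd u (fadd (val u) (val v)).
Let kact (g : G) (u : T) : T := insubd u (act g (val u)).

Let val_kadd u v : kproj u = kproj v -> val (kadd u v) = fadd (val u) (val v).
Proof. by move=> uv; rewrite insubd_val //; apply: kerD => //; exact: set_valP. Qed.

Let val_kact g u : src g = kproj u -> val (kact g u) = act g (val u).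
Proof. by move=> gu; rewrite insubd_val //; apply: kerJ => //; exact: set_valP. Qed.

Definition hom_kernel : gsheaf G.
Proof.
refine (@GSheaf G T kproj kzero kopp kadd kact _ _ _ _ _ _ _ _ _ _ _ _ _ _ _ _).
- apply/local_homeomorphismP; split=> [u|U [V oV <-]|u].
  + by apply: continuous_comp; [exact: val_set_continuous|exact: proj_continuous].
  + have -> : kproj @` (set_val @^-1` V) = @proj G A @` (V `&` hom_ker f).
      rewrite eqEsubset; split=> [_ [u Vu <-]|_ [a [Va fa] <-]].
        by exists (val u) => //; split=> //; exact: set_valP.
      by exists (SigSub (mem_set fa)).
    by apply: proj_open; apply: openI => //; exact: hom_ker_open.
  + have [U [oU Uu injU]] := proj_loc_inj (val u).
    exists (val @^-1` U); split=> //.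
      by move/continuousP: (@val_set_continuous A (hom_ker f)); exact.
    move=> v w; rewrite !inE => Uv Uw vw; apply: val_inj.
    by apply: injU; rewrite ?inE.
- by move=> x; rewrite /kproj proj_zero.
- by move=> u; rewrite /kproj proj_opp.
- by move=> u v uv; rewrite {1}/kproj val_kadd // proj_add.
- move=> u v w uv vw; apply: val_inj.
  have P x y : kproj x = kproj y -> kproj (kadd x y) = kproj x.
    by move=> xy; rewrite {1}/kproj val_kadd // proj_add.
  by rewrite !val_kadd ?P // ?fib_addA //; rewrite uv.
- by move=> u v uv; apply: val_inj; rewrite !val_kadd // fib_addC.
- by move=> u; apply: val_inj; rewrite val_kadd /= ?fib_add0 // /kproj proj_zero.
- by move=> u; apply: val_inj; rewrite val_kadd /= ?fib_addN // /kproj proj_opp.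
- by apply: continuous_set_type; exact: zero_continuous.
- apply: continuous_set_type.
  have -> : val \o kopp = @fopp G A \o val by [].
  move=> u; apply: continuous_comp; first exact: val_set_continuous.
  exact: opp_continuous.
- apply/within_prodP => u v uv W /nbhs_set_type[P /= nP PW].
  move: nP; rewrite val_kadd // => nP.
  have /within_prodP/(_ (val u) (val v) uv _ nP)[Q [R [nQ nR QR]]] := @add_continuous G A.
  exists (val @^-1` Q), (val @^-1` R); split; try exact: val_set_continuous.
  by move=> x y Qx Ry xy; apply: PW; rewrite val_kadd //; exact: QR.
- by move=> g u gu; rewrite {1}/kproj val_kact // proj_act.
- move=> g u v gu uv; apply: val_inj.
  rewrite val_kact ?val_kadd ?val_kact ?act_add //.
  + by rewrite gu uv.
  + by rewrite /kproj !val_kact ?proj_act //; rewrite gu uv.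
  + by rewrite /kproj val_kadd // proj_add.
- by move=> u; apply: val_inj; rewrite val_kact ?act_unit // src_unit.
- move=> g h u gh hu; apply: val_inj.
  by rewrite !val_kact ?act_mul // ?src_mul // /kproj val_kact // proj_act.
- apply/within_prodP => g u gu W /nbhs_set_type[P /= nP PW].
  move: nP; rewrite val_kact // => nP.
  have /within_prodP/(_ g (val u) gu _ nP)[Q [R [nQ nR QR]]] := @act_continuous G A.
  exists Q, (val @^-1` R); split=> //; first exact: val_set_continuous.
  by move=> x y Qx Ry xy; apply: PW; rewrite val_kact //; exact: QR.
Defined.

Definition kernel_incl : ghom hom_kernel A.
Proof.
exact: (@GHom G hom_kernel A val (@val_set_continuous _ _) (fun=> erefl) val_kadd val_kact).
Defined.

Lemma range_kernel_incl : range kernel_incl = hom_ker f.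
Proof.
rewrite eqEsubset; split=> [_ [u _ <-]|a fa]; first exact: (set_valP u).
by exists (SigSub (mem_set fa)).
Qed.

(** Later proofs obtain kernels in this form only, which hides the construction. *)
Lemma kernel_exists : exists (K : gsheaf G) (i : ghom K A),
  injective i /\ range i = hom_ker f.
Proof.
by exists hom_kernel, kernel_incl; split; [exact: val_inj|exact: range_kernel_incl].
Qed.

End Kernel.

(** * The direct sum of two sheaves, as their fibre product over the unit space *)

Section FibreProduct.
Variables (G : etale_groupoid) (A B : gsheaf G).

Let D := [set p : A * B | proj p.1 = proj p.2].
Let T : topologicalType := set_type D.

Let bproj (u : T) := proj (val u).1.

Let valD (u : T) : proj (val u).1 = proj (val u).2.
Proof. exact: (set_valP u). Qed.

Let D0 x : D (fzero A x, fzero B x).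
Proof. by rewrite /D /= !proj_zero. Qed.

Let DN (u : T) : D (fopp (val u).1, fopp (val u).2).
Proof. by rewrite /D /= !proj_opp valD. Qed.

Let bzero x : T := SigSub (mem_set (D0 x)).
Let bopp (u : T) : T := SigSub (mem_set (DN u)).
Let badd (u v : T) : T :=
  insubd u (fadd (val u).1 (val v).1, fadd (val u).2 (val v).2).
Let bact (g : G) (u : T) : T := insubd u (act g (val u).1, act g (val u).2).

Let val_badd u v : bproj u = bproj v ->
  val (badd u v) = (fadd (val u).1 (val v).1, fadd (val u).2 (val v).2).
Proof.
move=> uv; rewrite insubd_val // /D /= !proj_add -?valD //.
Qed.

Let val_bact g u : src g = bproj u ->
  val (bact g u) = (act g (val u).1, act g (val u).2).
Proof. by move=> gu; rewrite insubd_val // /D /= !proj_act -?valD. Qed.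

Let fst_continuous : continuous (fun u : T => (val u).1).
Proof.
have -> : (fun u : T => (val u).1) = fst \o (val : T -> A * B) by [].
move=> u; apply: continuous_comp; first exact: val_set_continuous.
exact: cvg_fst.
Qed.

Let snd_continuous : continuous (fun u : T => (val u).2).
Proof.
have -> : (fun u : T => (val u).2) = snd \o (val : T -> A * B) by [].
move=> u; apply: continuous_comp; first exact: val_set_continuous.
exact: cvg_snd.
Qed.

Let pairT_continuous (S : topologicalType) (h : S -> T) :
  continuous (fun s => (val (h s)).1) -> continuous (fun s => (val (h s)).2) ->
  continuous h.
Proof.
move=> h1 h2; apply: continuous_set_type => s.
have -> : val \o h = fun s => ((val (h s)).1, (val (h s)).2).
  by apply/funext => t /=; case: (val (h t)).
by apply: cvg_pair; [exact: h1|exact: h2].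
Qed.

Let nbhsT (u : T) (W : set T) : nbhs u W -> exists P R,
  [/\ nbhs (val u).1 P, nbhs (val u).2 R & forall v : T, P (val v).1 -> R (val v).2 -> W v].
Proof.
move=> /nbhs_set_type[X [[P R] /= [nP nR] PR] XW]; exists P, R; split=> // v Pv Rv.
by apply: XW; apply: PR.
Qed.

Definition fibprod : gsheaf G.
Proof.
refine (@GSheaf G T bproj bzero bopp badd bact _ _ _ _ _ _ _ _ _ _ _ _ _ _ _ _).
- apply/local_homeomorphismP; split=> [u|U oU|u].
  + apply: (@continuous_comp _ _ _ (fun w : T => (val w).1) (@proj G A)).
      exact: fst_continuous.
    exact: proj_continuous.
  + rewrite openE => _ [u Uu <-].
    have [P [R [nP nR PR]]] := nbhsT (open_nbhs_nbhs (conj oU Uu)).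
    move: nP nR; rewrite !nbhsE => -[P' [oP Pu] P'P] [R' [oR Ru] R'R].
    (* The box on [P'] and [R'] projects onto all of this intersection: two points over the same
       unit form an element of the fibre product. *)
    have oV : open (@proj G A @` P' `&` @proj G B @` R').
      by apply: openI; exact: proj_open.
    apply: filterS (open_nbhs_nbhs (conj oV _)).
      move=> _ [[a P'a <-] [b R'b pba]].
      exists (SigSub (mem_set (esym pba : D (a, b)))) => //.
      by apply: PR; [exact: P'P|exact: R'R].
    by split; [exists (val u).1|exists (val u).2] => //; rewrite -valD.
  + have [U [oU Uu injU]] := proj_loc_inj (val u).1.
    have [V [oV Vu injV]] := proj_loc_inj (val u).2.
    exists ((fun w : T => (val w).1) @^-1` U `&` (fun w : T => (val w).2) @^-1` V).
    split=> //.
      apply: openI; first by move/continuousP: fst_continuous; exact.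
      by move/continuousP: snd_continuous; exact.
    move=> v w; rewrite !inE => -[Uv Vv] [Uw Vw] vw; apply: val_inj.
    apply: injective_projections; first by apply: injU; rewrite ?inE.
    by apply: injV; rewrite ?inE // -!valD.
- by move=> x; rewrite /bproj proj_zero.
- by move=> u; rewrite /bproj proj_opp.
- by move=> u v uv; rewrite {1}/bproj val_badd // proj_add.
- move=> u v w uv vw; apply: val_inj.
  have P x y : bproj x = bproj y -> bproj (badd x y) = bproj x.
    by move=> xy; rewrite {1}/bproj val_badd // proj_add.
  rewrite !val_badd ?P //=; last by rewrite uv.
  by rewrite !fib_addA // -!valD.
- move=> u v uv; apply: val_inj; rewrite !val_badd //.
  by congr pair; rewrite fib_addC // -!valD.
- move=> u; apply: val_inj; rewrite val_badd /bproj /= ?proj_zero //.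
  by apply: injective_projections; rewrite /= ?fib_add0 // valD fib_add0.
- move=> u; apply: val_inj; rewrite val_badd /bproj /= ?proj_opp //.
  by rewrite !fib_addN valD.
- by apply: pairT_continuous; exact: zero_continuous.
- apply: pairT_continuous => u.
    apply: (@continuous_comp _ _ _ (fun w : T => (val w).1) (@fopp G A)).
      exact: fst_continuous.
    exact: opp_continuous.
  apply: (@continuous_comp _ _ _ (fun w : T => (val w).2) (@fopp G B)).
    exact: snd_continuous.
  exact: opp_continuous.
- apply/within_prodP => u v uv W /nbhsT[P [R]] /=.
  rewrite val_badd //= => -[nP nR PR].
  have uv2 : proj (val u).2 = proj (val v).2 by rewrite -!valD.
  have /within_prodP/(_ _ _ uv _ nP)[P1 [P2 [nP1 nP2 P12]]] := @add_continuous G A.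
  have /within_prodP/(_ _ _ uv2 _ nR)[R1 [R2 [nR1 nR2 R12]]] := @add_continuous G B.
  exists ((fun w : T => (val w).1) @^-1` P1 `&` (fun w : T => (val w).2) @^-1` R1).
  exists ((fun w : T => (val w).1) @^-1` P2 `&` (fun w : T => (val w).2) @^-1` R2).
  split; try by apply: filterI; [exact: fst_continuous|exact: snd_continuous].
  move=> x y [Px Rx] [Py Ry] xy; apply: PR; rewrite val_badd //=; first exact: P12.
  by apply: R12 => //=; rewrite -!valD.
- by move=> g u gu; rewrite {1}/bproj val_bact // proj_act.
- move=> g u v gu uv; apply: val_inj; have gv : src g = bproj v by rewrite gu.
  rewrite val_bact ?val_badd ?val_bact //.
  + by rewrite /= !act_add // -!valD.
  + by rewrite /bproj !val_bact //= !proj_act.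
  + by rewrite /bproj val_badd // proj_add.
- move=> u; apply: val_inj; rewrite val_bact ?src_unit //= /bproj act_unit.
  by apply: injective_projections; rewrite /= ?act_unit // valD act_unit.
- move=> g h u gh hu; apply: val_inj.
  have ? : src g = bproj (bact h u) by rewrite /bproj val_bact //= proj_act.
  by rewrite !val_bact //= ?src_mul // !act_mul // -valD.
- apply/within_prodP => g u gu W /nbhsT[P [R]] /=.
  rewrite val_bact //= => -[nP nR PR].
  have gu2 : src g = proj (val u).2 by rewrite -!valD.
  have /within_prodP/(_ _ _ gu _ nP)[P1 [P2 [nP1 nP2 P12]]] := @act_continuous G A.
  have /within_prodP/(_ _ _ gu2 _ nR)[R1 [R2 [nR1 nR2 R12]]] := @act_continuous G B.
  exists (P1 `&` R1).
  exists ((fun w : T => (val w).1) @^-1` P2 `&` (fun w : T => (val w).2) @^-1` R2).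
  split; [exact: filterI | |].
    by apply: filterI; [exact: fst_continuous|exact: snd_continuous].
  move=> x y [Px Rx] [Py Ry] xy; apply: PR; rewrite val_bact //=; first exact: P12.
  by apply: R12 => //=; rewrite -!valD.
Defined.

Definition fibprod_fst : ghom fibprod A.
Proof.
refine (@GHom G fibprod A (fun u : T => (val u).1) fst_continuous _ _ _) => //.
- by move=> u v uv; rewrite /= val_badd.
- by move=> g u gu; rewrite /= val_bact.
Defined.

Definition fibprod_snd : ghom fibprod B.
Proof.
refine (@GHom G fibprod B (fun u : T => (val u).2) snd_continuous _ _ _) => //.
- by move=> u; rewrite -valD.
- by move=> u v uv; rewrite /= val_badd.
- by move=> g u gu; rewrite /= val_bact.
Defined.

Let pairD C (f : ghom C A) (h : ghom C B) c : D (f c, h c).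
Proof. by rewrite /D /= !hom_proj. Qed.

Definition fibprod_pair C (f : ghom C A) (h : ghom C B) : ghom C fibprod.
Proof.
refine (@GHom G C fibprod (fun c => SigSub (mem_set (pairD f h c)) : T) _ _ _ _).
- by apply: pairT_continuous; exact: hom_continuous.
- by move=> c; rewrite /= /bproj /= hom_proj.
- move=> c d cd; apply: val_inj; rewrite /= val_badd /bproj /= ?hom_proj //.
  by rewrite !hom_add.
- move=> g c gc; apply: val_inj; rewrite /= val_bact /bproj /= ?hom_proj //.
  by rewrite !hom_act.
Defined.

Lemma fibprod_fst_pair C (f : ghom C A) (h : ghom C B) c :
  fibprod_fst (fibprod_pair f h c) = f c.
Proof. by []. Qed.

Lemma fibprod_snd_pair C (f : ghom C A) (h : ghom C B) c :
  fibprod_snd (fibprod_pair f h c) = h c.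
Proof. by []. Qed.

Lemma fibprod_elem a b : proj a = proj b ->
  exists2 w : fibprod, fibprod_fst w = a & fibprod_snd w = b.
Proof. by move=> ab; exists (SigSub (mem_set (ab : D (a, b)))). Qed.

Lemma fibprod_ext (u v : fibprod) :
  fibprod_fst u = fibprod_fst v -> fibprod_snd u = fibprod_snd v -> u = v.
Proof. by move=> uv1 uv2; apply: val_inj; exact: injective_projections. Qed.

End FibreProduct.

(** An interface to the direct sum: the projections, the pairing, and the description of elements by
    coordinates are enough for all the diagram chases below. *)
Record biproduct (G : etale_groupoid) (A B : gsheaf G) : Type := Biproduct {
  bip_obj : gsheaf G;
  bip_fst : ghom bip_obj A;
  bip_snd : ghom bip_obj B;
  bip_pair : forall C, ghom C A -> ghom C B -> ghom C bip_obj;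
  bip_fst_pair : forall C (f : ghom C A) (h : ghom C B) c,
    bip_fst (bip_pair f h c) = f c;
  bip_snd_pair : forall C (f : ghom C A) (h : ghom C B) c,
    bip_snd (bip_pair f h c) = h c;
  bip_elem : forall a b, proj a = proj b ->
    exists2 w, bip_fst w = a & bip_snd w = b;
  bip_ext : forall u v, bip_fst u = bip_fst v -> bip_snd u = bip_snd v -> u = v
}.

Section Biproduct.
Variables (G : etale_groupoid) (A B : gsheaf G).

(* Ends with [Qed]: conversion tests that unfold the fibre product take minutes. *)
Definition the_biproduct : biproduct A B.
Proof.
exact: Biproduct (@fibprod_fst_pair G A B) (@fibprod_snd_pair G A B)
  (@fibprod_elem G A B) (@fibprod_ext G A B).
Qed.

Definition biprod := bip_obj the_biproduct.
Definition biprod_fst : ghom biprod A := bip_fst the_biproduct.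
Definition biprod_snd : ghom biprod B := bip_snd the_biproduct.
Definition biprod_pair C (f : ghom C A) (h : ghom C B) : ghom C biprod :=
  bip_pair the_biproduct f h.

Lemma biprod_fst_pair C (f : ghom C A) (h : ghom C B) c :
  biprod_fst (biprod_pair f h c) = f c.
Proof. exact: bip_fst_pair. Qed.

Lemma biprod_snd_pair C (f : ghom C A) (h : ghom C B) c :
  biprod_snd (biprod_pair f h c) = h c.
Proof. exact: bip_snd_pair. Qed.

Lemma biprod_elem a b : proj a = proj b ->
  exists2 w, biprod_fst w = a & biprod_snd w = b.
Proof. exact: bip_elem. Qed.

Lemma biprod_ext (u v : biprod) :
  biprod_fst u = biprod_fst v -> biprod_snd u = biprod_snd v -> u = v.
Proof. exact: bip_ext. Qed.

End Biproduct.

(** * Cokernels *)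

Section Cokernel.
Variables (G : etale_groupoid) (A B : gsheaf G) (h : ghom A B).

(** Congruence modulo the image of [h]. The condition on base points makes the sum meaningful and
    keeps related points in one fibre. *)
Let E (b b' : B) := exists2 a, proj a = proj b' & fadd (h a) b' = b.

Let E_proj b b' : E b b' -> proj b = proj b'.
Proof. by move=> [a ab <-]; rewrite proj_add hom_proj. Qed.

Let E_refl b : E b b.
Proof. by exists (fzero A (proj b)); rewrite ?proj_zero // hom_fzero fib_add0. Qed.

Let E_sym b b' : E b b' -> E b' b.
Proof.
move=> bb'; case: (bb') => a ab <-; exists (fopp a).
  by rewrite proj_opp proj_add hom_proj.
rewrite hom_fopp fib_addA ?proj_opp ?hom_proj //.
by rewrite fib_addN hom_proj ab fib_add0.
Qed.

Let E_trans b b' b'' : E b b' -> E b' b'' -> E b b''.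
Proof.
move=> [a ab <-] [a' ab' bb']; rewrite -bb' proj_add ?hom_proj // in ab.
exists (fadd a a'); first by rewrite proj_add // ab.
by rewrite hom_add // -fib_addA ?hom_proj // bb'.
Qed.

Let e : rel B := fun b b' => `[< E b b' >].

Let e_refl : reflexive e. Proof. by move=> b; apply/asboolP. Qed.

Let e_sym : symmetric e.
Proof. by move=> b b'; apply/asboolP/asboolP => ?; exact: E_sym. Qed.

Let e_trans : transitive e.
Proof.
move=> b b' b'' /asboolP b1 /asboolP b2; apply/asboolP; exact: E_trans b1 b2.
Qed.

Let e_equiv : equiv_rel B := EquivRel e e_refl e_sym e_trans.

Let T : topologicalType := quotient_topology {eq_quot e_equiv}.
Let p (b : B) : T := \pi_{eq_quot e_equiv} b.
Let r (x : T) : B := repr (x : {eq_quot e_equiv}).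

Let pr x : p (r x) = x. Proof. exact: reprK. Qed.

Let pW (P : T -> Prop) : (forall b, P (p b)) -> forall x, P x.
Proof. by move=> Pp x; rewrite -(pr x). Qed.

Let pE b b' : p b = p b' <-> E b b'.
Proof.
split=> [/eqquotP/asboolP //|bb'].
by apply/eqquotP/asboolP.
Qed.

Let rpE b : E (r (p b)) b. Proof. by apply/pE; rewrite pr. Qed.

Let p_continuous : continuous p. Proof. exact: pi_continuous. Qed.

(** The saturation of [U] consists of the sums [h a + u] with [u] in [U], so it is the image of an
    open set under the morphism [s] from the direct sum, and morphisms are open. *)
Let p_open U : open U -> open (p @` U).
Proof.
(* A set is open in the quotient topology when its preimage under [p] is. *)
move=> oU; change (open (p @^-1` (p @` U))).
pose s := hom_addition (comp_hom h (biprod_fst A B)) (biprod_snd A B).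
have -> : p @^-1` (p @` U) = s @` (biprod_snd A B @^-1` U).
  rewrite eqEsubset; split=> [b [u Uu /esym/pE[a ab <-]]|_ [w Uw <-]] /=.
    by have [w <- wu] := biprod_elem ab; move: Uu; rewrite -wu; exists w.
  exists (biprod_snd A B w) => //; apply/esym/pE.
  by exists (biprod_fst A B w); rewrite ?hom_proj.
by apply: hom_open; move/continuousP: (@hom_continuous G _ _ (biprod_snd A B)); exact.
Qed.

Let p_nbhs b U : nbhs b U -> nbhs (p b) (p @` U).
Proof.
rewrite nbhsE => -[U' [oU U'b] U'U].
apply: filterS (open_nbhs_nbhs (conj (p_open oU) _)); first exact: image_subset.
by exists b.
Qed.

(** Projection, negation, addition and action use the arbitrary representatives [r]; the lemmas
    [qprojE] to [qactE] show that any other representatives give the same result. *)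
Let qproj (x : T) := proj (r x).
Let qzero x : T := p (fzero B x).
Let qopp (x : T) : T := p (fopp (r x)).
Let qadd (x y : T) : T := p (fadd (r x) (r y)).
Let qact (g : G) (x : T) : T := p (act g (r x)).

Let qprojE b : qproj (p b) = proj b. Proof. exact: E_proj (rpE b). Qed.

Let qoppE b : qopp (p b) = p (fopp b).
Proof.
apply/pE; have [a ab <-] := rpE b; exists (fopp a); first by rewrite !proj_opp.
rewrite hom_fopp; apply: fib_opp_uniq; rewrite ?proj_add ?proj_opp ?hom_proj //.
by rewrite fib_addACA ?proj_opp ?hom_proj // !fib_addNr hom_proj ab fib_add00.
Qed.

Let qaddE b c : proj b = proj c -> qadd (p b) (p c) = p (fadd b c).
Proof.
move=> bc; apply/pE; have [a ab <-] := rpE b; have [d dc <-] := rpE c.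
have ad : proj a = proj d by rewrite ab dc.
exists (fadd a d); first by rewrite !proj_add.
by rewrite hom_add // fib_addACA ?hom_proj // dc.
Qed.

Let qactE g b : src g = proj b -> qact g (p b) = p (act g b).
Proof.
move=> gb; apply/pE; have [a ab <-] := rpE b; exists (act g a).
  by rewrite !proj_act // gb.
by rewrite hom_act ?gb // act_add ?hom_proj ?gb.
Qed.

Definition hom_cokernel : gsheaf G.
Proof.
refine (@GSheaf G T qproj qzero qopp qadd qact _ _ _ _ _ _ _ _ _ _ _ _ _ _ _ _).
- apply/local_homeomorphismP; split=> [|U oU|].
  + apply/(@quotient_continuous B {eq_quot e_equiv} _ qproj).
    have -> : qproj \o \pi_(quotient_topology {eq_quot e_equiv}) = @proj G B.
      by apply/funext => b; exact: qprojE.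
    exact: proj_continuous.
  + have -> : qproj @` U = @proj G B @` (p @^-1` U).
      rewrite eqEsubset; split=> [_ [x Ux <-]|_ [b Ub <-]].
        by exists (r x) => //; rewrite /preimage /= pr.
      by exists (p b); rewrite // qprojE.
    by apply: proj_open; move/continuousP: p_continuous; exact.
  + apply: (pW _) => b; have [U [oU Ub injU]] := proj_loc_inj b.
    exists (p @` U); split; [exact: p_open|by exists b|].
    move=> x y; rewrite !inE => -[u Uu <-] [v Uv <-]; rewrite !qprojE => uv.
    by congr p; apply: injU; rewrite ?inE.
- by move=> x; rewrite qprojE proj_zero.
- by apply: (pW _) => b; rewrite qoppE !qprojE proj_opp.
- apply: (pW _) => b; apply: (pW _) => c bc; rewrite !qprojE in bc.
  by rewrite qaddE // !qprojE proj_add.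
- apply: (pW _) => a; apply: (pW _) => b; apply: (pW _) => c ab bc; rewrite !qprojE in ab bc.
  by rewrite !qaddE ?proj_add // ?fib_addA // ab.
- by apply: (pW _) => b; apply: (pW _) => c bc; rewrite !qprojE in bc; rewrite !qaddE // fib_addC.
- by apply: (pW _) => b; rewrite qprojE qaddE ?proj_zero // fib_add0.
- by apply: (pW _) => b; rewrite qoppE qaddE ?proj_opp // fib_addN qprojE.
- by move=> x; apply: (continuous_comp (@zero_continuous G B x)); exact: p_continuous.
- apply/(@quotient_continuous B {eq_quot e_equiv} _ qopp).
  have -> : qopp \o \pi_(quotient_topology {eq_quot e_equiv}) = p \o @fopp G B.
    by apply/funext => b; exact: qoppE.
  by move=> x; apply: (continuous_comp (@opp_continuous G B x)); exact: p_continuous.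
(* A product of quotient maps need not be a quotient map. Openness of [p] replaces this: it carries
   neighbourhoods of [b] and [c] to neighbourhoods of their classes. *)
- apply/within_prodP; apply: (pW _) => b; apply: (pW _) => c /= bc U; rewrite !qprojE in bc.
  rewrite qaddE // => /p_continuous nU.
  have /within_prodP/(_ b c bc _ nU)[P [R [nP nR PR]]] := @add_continuous G B.
  exists (p @` P), (p @` R); split; try exact: p_nbhs.
  move=> _ _ [u Pu <-] [v Rv <-] /= uv; rewrite !qprojE in uv; rewrite qaddE //.
  exact: PR.
- by move=> g; apply: (pW _) => b gb; rewrite qprojE in gb; rewrite qactE // qprojE proj_act.
- move=> g; apply: (pW _) => b; apply: (pW _) => c gb bc; rewrite !qprojE in gb bc.
  by rewrite qaddE // !qactE ?qaddE ?act_add ?proj_act ?proj_add ?gb.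
- by apply: (pW _) => b; rewrite qprojE qactE ?src_unit // act_unit.
- move=> g k; apply: (pW _) => b gk kb; rewrite qprojE in kb.
  by rewrite !qactE ?src_mul ?proj_act // act_mul.
- apply/within_prodP => g; apply: (pW _) => b /= gb U; rewrite qprojE in gb.
  rewrite qactE // => /p_continuous nU.
  have /within_prodP/(_ g b gb _ nU)[P [R [nP nR PR]]] := @act_continuous G B.
  exists P, (p @` R); split; [by []|exact: p_nbhs|].
  move=> k _ Pk [v Rv <-] /= kv; rewrite qprojE in kv; rewrite qactE //.
  exact: PR.
Defined.

Definition cokernel_proj : ghom B hom_cokernel.
Proof.
refine (@GHom G B hom_cokernel p p_continuous qprojE _ _).
- by move=> a b /qaddE.
- by move=> g a /qactE.
Defined.

Lemma range_cokernel_proj : range cokernel_proj = setT.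
Proof. by apply/seteqP; split=> // => x _; exists (r x) => //; exact: pr. Qed.

Lemma ker_cokernel_proj : hom_ker cokernel_proj = range h.
Proof.
rewrite eqEsubset; split=> [b /pE[a ab <-]|_ [a _ <-]].
  exists a => //; rewrite -[LHS]fib_add0r; congr fadd; congr fzero.
  by rewrite hom_proj ab proj_zero.
apply/pE; exists a; first by rewrite proj_zero !hom_proj.
by rewrite -[RHS]fib_add0r !hom_proj.
Qed.

Lemma cokernel_exists : exists (C : gsheaf G) (q : ghom B C),
  range q = setT /\ hom_ker q = range h.
Proof.
by exists hom_cokernel, cokernel_proj; split;
  [exact: range_cokernel_proj|exact: ker_cokernel_proj].
Qed.

End Cokernel.

(** * Pushouts and cocycle diagrams *)

Section Exactness.
Variable G : etale_groupoid.
Implicit Types A B C N P : gsheaf G.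

Lemma comp_hom_surjI A B C (p : ghom A B) (f g : ghom B C) :
  range p = setT -> comp_hom f p = comp_hom g p -> f = g.
Proof.
move=> sp fg; apply: hom_ext => b.
have : range p b by rewrite sp.
by case=> a _ <-; exact: (congr1 (fun k : ghom A C => k a) fg).
Qed.

Lemma comp_hom_injI A B C (i : ghom B C) (f g : ghom A B) :
  injective i -> comp_hom i f = comp_hom i g -> f = g.
Proof.
move=> ii fg; apply: hom_ext => a; apply: ii.
exact: (congr1 (fun k : ghom A C => k a) fg).
Qed.

Lemma comp_homA A B C N (f : ghom A B) (g : ghom B C) (h : ghom C N) :
  comp_hom h (comp_hom g f) = comp_hom (comp_hom h g) f.
Proof. exact: hom_ext. Qed.

Lemma comp_homE A B C (f : ghom A B) (g : ghom B C) a : comp_hom g f a = g (f a).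
Proof. by []. Qed.

Lemma comp_hom_app A B C (f : ghom A B) (g : ghom B C) (h : ghom A C) a :
  comp_hom g f = h -> g (f a) = h a.
Proof. by move=> <-. Qed.

(** Cuts a long exact sequence at [d]: when [i] represents the image of [d], the kernel, the source
    and the image of [d] form a short exact sequence. *)
Lemma short_exact_factor A B C N (j : ghom A B) (d : ghom B N) (i : ghom C N)
    (p : ghom B C) :
  injective j -> range j = hom_ker d -> injective i -> range d = range i ->
  comp_hom i p = d -> short_exact j p.
Proof.
move=> ij rj ii rd ipd; split=> //.
  rewrite rj; apply/seteqP; split=> b; rewrite /hom_ker /= -ipd /= => ib.
    by apply: ii; rewrite ib hom_fzero.
  by rewrite ib hom_fzero.
apply/seteqP; split=> // c _.
have [b _ db] : range d (i c) by rewrite rd; exists c.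
by exists b => //; apply: ii; rewrite (comp_hom_app _ ipd).
Qed.

Lemma hom_kerE A B (f : ghom A B) a : hom_ker f a = (f a = fzero B (proj a)).
Proof. by []. Qed.

(** [R] is the cokernel of the map [h] with components [c] and [- t]. The kernel condition on [c] is
    what makes [A] embed in [R]; the map [b] is [d] on the second summand. *)
Lemma pushout_exact A P N B (c : ghom P A) (t : ghom P N) (d : ghom N B) :
  range t = hom_ker d -> hom_ker t `<=` hom_ker c ->
  exists (R : gsheaf G) (i : ghom A R) (v : ghom N R) (b : ghom R B),
    [/\ injective i, range i = hom_ker b, range b = range d,
        comp_hom i c = comp_hom v t & comp_hom b v = d].
Proof.
move=> td tc; pose h := biprod_pair c (hom_opposite t).
have [R [q [sq kq]]] := cokernel_exists h.
pose i1 : ghom A (biprod A N) := biprod_pair (id_hom A) (hom_zero A N).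
pose i2 : ghom N (biprod A N) := biprod_pair (hom_zero N A) (id_hom N).
have h1 z : biprod_fst A N (h z) = c z by exact: biprod_fst_pair.
have h2 z : biprod_snd A N (h z) = fopp (t z) by exact: biprod_snd_pair.
have i11 a : biprod_fst A N (i1 a) = a by exact: biprod_fst_pair.
have i12 a : biprod_snd A N (i1 a) = fzero N (proj a) by exact: biprod_snd_pair.
have i21 y : biprod_fst A N (i2 y) = fzero A (proj y) by exact: biprod_fst_pair.
have i22 y : biprod_snd A N (i2 y) = y by exact: biprod_snd_pair.
have qh z : q (h z) = fzero R (proj z).
  have : hom_ker q (h z) by rewrite kq; exists z.
  by rewrite hom_kerE => ->; rewrite hom_proj.
have dt z : d (t z) = fzero B (proj z).
  have : hom_ker d (t z) by rewrite -td; exists z.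
  by rewrite hom_kerE => ->; rewrite hom_proj.
(* The map [d] on the second summand descends to [R] because [d] vanishes on the range of [t]. *)
have [|b bq] := @hom_factor_surj _ _ _ _ q (comp_hom d (biprod_snd A N)) sq.
  rewrite kq => _ [z _ <-]; rewrite hom_kerE hom_proj comp_homE h2 hom_fopp dt.
  by apply/esym/fib_opp_uniq; rewrite ?fib_add00 proj_zero.
have bqE w : b (q w) = d (biprod_snd A N w) by rewrite (comp_hom_app _ bq).
exists R, (comp_hom q i1), (comp_hom q i2), b; split.
(* If [(a, 0)] dies in [R] then [(a, 0) = h z], so [t z = 0], and then [a = c z = 0]. *)
- apply: hom_injective => a qa.
  have [z _ hz] : range h (i1 a) by rewrite -kq hom_kerE hom_proj; exact: qa.
  have cz : c z = a by rewrite -h1 hz i11.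
  have tz : fopp (t z) = fzero N (proj a) by rewrite -h2 hz i12.
  rewrite -cz hom_proj; apply: tc; rewrite hom_kerE -(fib_oppK (t z)) tz.
  apply/esym/fib_opp_uniq; rewrite -cz ?hom_proj ?proj_zero //.
  exact: fib_add00.
- apply/seteqP; split=> [_ [a _ <-]|x].
    by rewrite hom_kerE hom_proj comp_homE bqE i12 hom_fzero.
  have [w _ <-] : range q x by rewrite sq.
  rewrite hom_kerE bqE => dw.
  have [z _ tz] : range t (biprod_snd A N w).
    by rewrite td hom_kerE dw !hom_proj.
  have pzw : proj z = proj w by rewrite -(hom_proj t) tz hom_proj.
  (* As the second coordinate of [w] is [t z], adding [h z] clears it without changing the class of
     [w] in [R]. *)
  exists (fadd (biprod_fst A N w) (c z)) => //.
  rewrite comp_homE.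
  have -> : i1 (fadd (biprod_fst A N w) (c z)) = fadd w (h z).
    apply: biprod_ext; rewrite ?(i11, i12) hom_add ?hom_proj // ?(h1, h2) //.
    by rewrite -tz fib_addNr proj_add !hom_proj ?pzw.
  by rewrite hom_add ?hom_proj // qh pzw -(hom_proj q) fib_add0r.
- apply/seteqP; split=> [_ [x _ <-]|_ [y _ <-]].
    have [w _ <-] : range q x by rewrite sq.
    by rewrite bqE; exists (biprod_snd A N w).
  by exists (q (i2 y)) => //; rewrite bqE i22.
- apply: hom_ext => z; rewrite !comp_homE.
  (* Here [(c z, 0) = h z + (0, t z)], and [q] kills [h z]. *)
  have -> : i1 (c z) = fadd (h z) (i2 (t z)).
    apply: biprod_ext; rewrite hom_add ?hom_proj // ?(i11, i12, i21, i22, h1, h2).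
      by rewrite hom_proj -(hom_proj c) fib_add0r.
    by rewrite fib_addN !hom_proj.
  rewrite hom_add ?hom_proj // qh.
  by rewrite -(hom_proj t z) -(hom_proj i2) -(hom_proj q) fib_add0.
- by apply: hom_ext => y; rewrite !comp_homE bqE i22.
Qed.

End Exactness.

(** An element of [Ext] is a predicate, so extensionality reduces equality to symmetry and
    transitivity of [nfold_equiv]. *)
Lemma ext_class_eq (G : etale_groupoid) (A : gsheaf G) m (E F : nfold A m) :
  nfold_equiv E F -> ext_class E = ext_class F.
Proof.
move=> EF; apply: eq_exist; apply/funext => X; apply/propext.
by split=> [|]; apply: rst_trans; [exact: rst_sym|].
Qed.

(** * Cocycle diagrams and the dependence of the bottom row on the cocycle *)

Section Diagrams.
Variables (G : etale_groupoid) (A : gsheaf G) (Q : resolution G).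

Lemma cocycle0 n (c : cocycle Q A n) : comp_hom c (aug_bd Q n.+1) = 0.
Proof. exact/eqP/(valP c). Qed.

(** By exactness this kernel is the range of the next boundary map, on which a cocycle vanishes. It
    is the form of the cocycle condition needed to factor [c] and to form the pushout. *)
Lemma cocycle_ker n (c : cocycle Q A n) : hom_ker (aug_bd Q n) `<=` hom_ker c.
Proof.
move=> q; have := res_exact Q n.+1; rewrite /aug_cycles => <- [z _ <-].
rewrite hom_kerE (comp_hom_app _ (cocycle0 c)) hom_proj; exact: erefl.
Qed.

Lemma cocycle_diagram_exists m (c : cocycle Q A m.+1) : inhabited (cocycle_diagram c).
Proof.
have [R [i [v [b [ii ri rb icv bv]]]]] :=
  pushout_exact (res_exact Q m.+1) (@cocycle_ker _ c).
have ex : nfold_exact i b.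
  by split=> // [|k _]; rewrite ?rb; exact: res_exact.
exact: (inhabits (CocycleDiagram ex icv bv (cocycle0 c))).
Qed.

Lemma coh_class_eq n (c c' : cocycle Q A n) :
  coh_class c = coh_class c' <-> coboundary (cocycle_hom c - cocycle_hom c').
Proof.
rewrite -cocycle_homB; split=> [/eqP|cc'].
  by rewrite /coh_class -Quotient.idealrBE unfold_in => /asboolP.
by apply/eqP; rewrite /coh_class -Quotient.idealrBE unfold_in; apply/asboolP.
Qed.

(** Both diagrams are arbitrary, so the case [c = c'] also shows independence of the chosen diagram.
    The morphism is obtained by descending [f] along the cover [s] of the first middle sheaf. *)
Lemma bottom_row_map m (c c' : cocycle Q A m.+1) (D : cocycle_diagram c)
    (D' : cocycle_diagram c') :
  coh_class c = coh_class c' -> nfold_map (bottom_row D) (bottom_row D').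
Proof.
move=> /coh_class_eq[g cg]; rewrite /nfold_map /=.
have [ii ri rb _] := cd_exact D; have [ii' ri' rb' _] := cd_exact D'.
set i := cd_inj D in ii ri *; set b := cd_bd D in ri rb *; pose v := cd_vert D.
set i' := cd_inj D' in ii' ri' *; set b' := cd_bd D' in ri' rb' *; pose v' := cd_vert D'.
have icv z : i (c z) = v (aug_bd Q m.+1 z) := comp_hom_app z (cd_square_c D).
have icv' z : i' (c' z) = v' (aug_bd Q m.+1 z) := comp_hom_app z (cd_square_c D').
have bv q : b (v q) = aug_bd Q m q := comp_hom_app q (cd_square_id D).
have bv' q : b' (v' q) = aug_bd Q m q := comp_hom_app q (cd_square_id D').
have bi a : b (i a) = fzero _ (proj a).
  have : hom_ker b (i a) by rewrite -ri; exists a.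
  by rewrite hom_kerE hom_proj.
have bi' a : b' (i' a) = fzero _ (proj a).
  have : hom_ker b' (i' a) by rewrite -ri'; exists a.
  by rewrite hom_kerE hom_proj.
have cE z : c z = fadd (c' z) (g (aug_bd Q m.+1 z)).
  have -> : cocycle_hom c = cocycle_hom c' + comp_hom g (aug_bd Q m.+1).
    by rewrite -cg addrC subrK.
  by [].
pose p1 := biprod_fst A (Q m); pose p2 := biprod_snd A (Q m).
(* On a pair [(a, q)], [s] is [i a + v q], while [f] is [i' a + v' q + i' (g q)]; the last term
   corrects for the coboundary. *)
pose s := hom_addition (comp_hom i p1) (comp_hom v p2).
pose f := hom_addition (comp_hom i' p1)
  (comp_hom (hom_addition v' (comp_hom i' g)) p2).
have sE w : s w = fadd (i (p1 w)) (v (p2 w)) by [].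
have fE w : f w = fadd (i' (p1 w)) (fadd (v' (p2 w)) (i' (g (p2 w)))) by [].
have bs w : b (s w) = aug_bd Q m (p2 w).
  rewrite sE hom_add ?hom_proj // bi bv hom_proj -(hom_proj p2).
  by rewrite -(hom_proj (aug_bd Q m)) fib_add0.
have bf w : b' (f w) = aug_bd Q m (p2 w).
  rewrite fE !hom_add ?hom_proj ?proj_add ?hom_proj // !bi' bv' !hom_proj.
  rewrite -(hom_proj p2) -(hom_proj (aug_bd Q m)) fib_add0r.
  by rewrite fib_add0.
have ss : range s = setT.
  apply/seteqP; split=> // x _.
  (* Exactness of both rows at the target of [b] gives [q] with the same image as [x]; then
     [x - v q] lies in the kernel of [b], hence in the range of [i]. *)
  have [q _ qx] : range (aug_bd Q m) (b x) by rewrite res_exact -rb; exists x.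
  have xq : proj x = proj q by rewrite -(hom_proj b) -qx hom_proj.
  have [a _ ax] : range i (fadd x (fopp (v q))).
    rewrite ri hom_kerE hom_add ?hom_fopp ?proj_opp ?hom_proj // bv qx.
    by rewrite fib_addNr hom_proj proj_add // proj_opp hom_proj.
  have aq : proj a = proj q by rewrite -(hom_proj i) ax proj_add ?proj_opp ?hom_proj.
  have [w wa wq] := biprod_elem aq; exists w => //.
  by rewrite sE /p1 /p2 wa wq ax fib_addrNK // hom_proj.
have sf : hom_ker s `<=` hom_ker f.
  move=> w; rewrite !hom_kerE => sw.
  (* If [s w = 0], the second coordinate of [w] is a boundary, of [z] say. Then [a + c z = 0] for
     the first coordinate [a], by injectivity of [i], and [f w] equals [i' (a + c z)]. *)
  have [z _ zw] : range (aug_bd Q m.+1) (p2 w).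
    by rewrite res_exact /aug_cycles hom_kerE -bs sw hom_fzero hom_proj.
  have pzw : proj z = proj w by rewrite -(hom_proj (aug_bd Q m.+1)) zw hom_proj.
  have acz : fadd (p1 w) (c z) = fzero A (proj w).
    by apply: ii; rewrite hom_add ?hom_proj // icv zw -sE sw hom_fzero.
  rewrite fE -zw -icv' -hom_add ?hom_proj // -cE -hom_add ?hom_proj //.
  by rewrite acz hom_fzero.
have [k ks] := hom_factor_surj ss sf.
have ksE w : k (s w) = f w := comp_hom_app w ks.
exists (fun n => id_hom (Q n)), k; split.
(* On [A], evaluate at the pair [(a, 0)], where [s] gives [i a] and [f] gives [i' a]. *)
- apply: hom_ext => a.
  have az : proj a = proj (fzero (Q m) (proj a)) by rewrite proj_zero.
  have [w wa wz] := biprod_elem az.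
  have E (R : gsheaf G) (j : ghom A R) : fadd (j a) (fzero R (proj a)) = j a.
    by rewrite -(hom_proj j) fib_add0r.
  have ia : i a = s w by rewrite sE /p1 /p2 wa wz hom_fzero E.
  rewrite comp_homE ia ksE fE /p1 /p2 wa wz !hom_fzero fib_add00.
  exact: E.
- apply: hom_ext => x; have [w _ <-] : range s x by rewrite ss.
  rewrite !comp_homE ksE; apply: (etrans (bf w)); rewrite -bs.
  (* [aug_target_map] is defined by cases on the degree, and here is the identity in each of
     them. *)
  by case: (m) (b (s w)) => [|n].
- move=> n _; apply: hom_ext => q; rewrite !comp_homE.
  by case: n q => [|n] q.
Qed.

(** Exactness in degree 0 says that [aug_bd Q 0] is onto the constant sheaf: [c] descends along it,
    and the descent is unique. *)
Lemma cocycle_factor (c : cocycle Q A 0) : exists! ct : ghom (const_Z G) A,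
  cocycle_hom c = comp_hom ct (aug_bd Q 0).
Proof.
have [ct ctE] := hom_factor_surj (res_exact Q 0) (@cocycle_ker _ c).
exists ct; split=> // ct' ctE'; apply: (comp_hom_surjI (res_exact Q 0)).
by rewrite ctE -ctE'.
Qed.

(** The universal property of cocycles modulo coboundaries; both the positive degrees and degree 0
    use it to define the homomorphism. *)
Lemma cohomology_lift n (V : zmodType) (phi : cocycle Q A n -> V) :
  {morph phi : c d / c - d} ->
  (forall c : cocycle Q A n, coboundary (cocycle_hom c) -> phi c = 0) ->
  exists rho : {additive resolution_cohomology Q A n -> V},
    forall c, rho (coh_class c) = phi c.
Proof.
move=> phiB phi0.
pose rho (x : resolution_cohomology Q A n) : V := phi (repr x).
(* The chosen representative of the class of [c] differs from [c] by a coboundary, which [phi]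
   kills. *)
have rhoE c : rho (coh_class c) = phi c.
  apply/eqP; rewrite -subr_eq0 -phiB; apply/eqP/phi0; rewrite cocycle_homB.
  by apply/coh_class_eq; exact: reprK.
have rhoB : zmod_morphism rho.
  move=> x y; rewrite -(reprK x) -(reprK y) -raddfB.
  by rewrite !rhoE phiB.
pose rhoA := GRing.isZmodMorphism.Build _ _ rho rhoB.
pose rho' : {additive resolution_cohomology Q A n -> V} := HB.pack rho rhoA.
by exists rho'.
Qed.

End Diagrams.

(** * The homomorphism to sheaf cohomology *)

Section Cohomology.
Variables (G : etale_groupoid) (H : sheaf_cohomology G).
Implicit Types A B C : gsheaf G.

Lemma biprod_exact_l A B :
  short_exact (biprod_pair (id_hom A) (hom_zero A B)) (biprod_snd A B).
Proof.
split.
- by move=> a b /(congr1 (biprod_fst A B)); rewrite !biprod_fst_pair.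
- apply/seteqP; split=> [_ [a _ <-]|w].
    by rewrite hom_kerE biprod_snd_pair hom_proj.
  rewrite hom_kerE => w0; exists (biprod_fst A B w) => //.
  apply: biprod_ext; rewrite ?biprod_fst_pair ?biprod_snd_pair // w0.
  exact: (congr1 (fzero B) (hom_proj (biprod_fst A B) w)).
- apply/seteqP; split=> // b _; exists (biprod_pair (hom_zero B A) (id_hom B) b) => //.
  exact: biprod_snd_pair.
Qed.

Lemma biprod_exact_r A B :
  short_exact (biprod_pair (hom_zero B A) (id_hom B)) (biprod_fst A B).
Proof.
split.
- by move=> a b /(congr1 (biprod_snd A B)); rewrite !biprod_snd_pair.
- apply/seteqP; split=> [_ [b _ <-]|w].
    by rewrite hom_kerE biprod_fst_pair hom_proj.
  rewrite hom_kerE => w0; exists (biprod_snd A B w) => //.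
  apply: biprod_ext; rewrite ?biprod_fst_pair ?biprod_snd_pair // w0.
  exact: (congr1 (fzero A) (hom_proj (biprod_snd A B) w)).
- apply/seteqP; split=> // a _; exists (biprod_pair (id_hom A) (hom_zero A B) a) => //.
  exact: biprod_fst_pair.
Qed.

Lemma coh_map_exact0 n A B C (f : ghom A B) (g : ghom B C) (x : H n A) :
  short_exact f g -> coh_map H n g (coh_map H n f x) = 0.
Proof.
move=> /(coh_exact_mid H n) E.
have : range (coh_map H n f) (coh_map H n f x) by exists x.
by rewrite E.
Qed.

Lemma coh_map_retract n A B (i : ghom A B) (r : ghom B A) (x : H n A) :
  comp_hom r i = id_hom A -> coh_map H n r (coh_map H n i x) = x.
Proof. by move=> ri; rewrite -coh_map_comp ri coh_map_id. Qed.

(* Additivity of H^n in the morphism is not an axiom of [sheaf_cohomology];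
   it follows from the two split exact sequences of the biproduct. *)
Lemma coh_mapD n A B (f g : ghom A B) (x : H n A) :
  coh_map H n (f + g) x = coh_map H n f x + coh_map H n g x.
Proof.
pose p1 := biprod_fst B B; pose p2 := biprod_snd B B.
pose i1 : ghom B (biprod B B) := biprod_pair (id_hom B) (hom_zero B B).
pose i2 : ghom B (biprod B B) := biprod_pair (hom_zero B B) (id_hom B).
have p1i1 y : coh_map H n p1 (coh_map H n i1 y) = y.
  apply: coh_map_retract; apply: hom_ext => b; exact: biprod_fst_pair.
have p2i2 y : coh_map H n p2 (coh_map H n i2 y) = y.
  apply: coh_map_retract; apply: hom_ext => b; exact: biprod_snd_pair.
have ex1 : short_exact i1 p2 := biprod_exact_l B B.
have ex2 : short_exact i2 p1 := biprod_exact_r B B.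
pose s : ghom (biprod B B) B := hom_addition p1 p2.
have s1 y : coh_map H n s (coh_map H n i1 y) = y.
  apply: coh_map_retract; apply: hom_ext => b.
  rewrite comp_homE [LHS]/(fadd (p1 (i1 b)) (p2 (i1 b))).
  by rewrite /p1 /p2 /i1 biprod_fst_pair biprod_snd_pair; exact: fib_add0r.
have s2 y : coh_map H n s (coh_map H n i2 y) = y.
  apply: coh_map_retract; apply: hom_ext => b.
  rewrite comp_homE [LHS]/(fadd (p1 (i2 b)) (p2 (i2 b))).
  by rewrite /p1 /p2 /i2 biprod_fst_pair biprod_snd_pair; exact: fib_add0.
pose z := coh_map H n (biprod_pair f g) x.
have z1 : coh_map H n p1 z = coh_map H n f x.
  rewrite -coh_map_comp; congr (coh_map H n _ x).
  by apply: hom_ext => a; rewrite comp_homE /p1 biprod_fst_pair.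
have z2 : coh_map H n p2 z = coh_map H n g x.
  rewrite -coh_map_comp; congr (coh_map H n _ x).
  by apply: hom_ext => a; rewrite comp_homE /p2 biprod_snd_pair.
have sz : coh_map H n s z = coh_map H n (f + g) x.
  rewrite -coh_map_comp; congr (coh_map H n _ x).
  apply: hom_ext => a; rewrite comp_homE.
  rewrite [LHS]/(fadd (p1 (biprod_pair f g a)) (p2 (biprod_pair f g a))).
  by rewrite /p1 /p2 biprod_fst_pair biprod_snd_pair.
(* This difference is killed by [p2], so it comes from the first summand. Hence [z] is the sum of
   its two components, and applying [s] gives the formula. *)
have [w _ wE] : range (coh_map H n i1) (z - coh_map H n i2 (coh_map H n p2 z)).
  by rewrite (coh_exact_mid H n ex1) /= raddfB /= p2i2 subrr.
have w1 : w = coh_map H n p1 z.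
  have := congr1 (coh_map H n p1) wE.
  by rewrite raddfB /= p1i1 coh_map_exact0 // subr0.
rewrite -sz -[z](subrK (coh_map H n i2 (coh_map H n p2 z))) -wE w1 z1 z2.
by rewrite raddfD /= s1 s2.
Qed.

Lemma coh_mapB n A B (f g : ghom A B) (x : H n A) :
  coh_map H n (f - g) x = coh_map H n f x - coh_map H n g x.
Proof. by apply: (addIr (coh_map H n g x)); rewrite -coh_mapD !subrK. Qed.

(** Consecutive maps of the long exact sequence compose to zero. This kills coboundaries: they
    induce maps on the kernel sheaf that extend to the middle term. *)
Lemma coh_map_comp_delta n A B C D (f : ghom A B) (g : ghom B C) (fg : short_exact f g)
    (h : ghom B D) (x : H n C) :
  coh_map H n.+1 (comp_hom h f) (coh_delta H n fg x) = 0.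
Proof.
rewrite coh_map_comp.
have : range (coh_delta H n fg) (coh_delta H n fg x) by exists x.
by rewrite (coh_exact_left H) /= => ->; rewrite raddf0.
Qed.

(** By induction: the next kernel sheaf is the kernel of [aug_bd Q n], whose corestriction to the
    current one gives the short exact sequence for the next connecting map. It starts at the
    constant sheaf, where everything is a cycle. *)
Lemma iterated_delta_exists (Q : resolution G) n :
  exists (K : gsheaf G) (i : ghom K (aug_target Q n)) (x : H n K),
    [/\ injective i, range i = @aug_cycles G Q n & iterated_delta i x].
Proof.
elim: n => [|n [K [i [x [ii ri ix]]]]].
  exists (const_Z G), (id_hom (const_Z G)), (coh_hom H (const_Z G) (id_hom (const_Z G))).
  split; [by []| |exact: Iterated_delta0].
  by apply/seteqP; split=> // a _; exists a.
have dE : range (aug_bd Q n) = range i by rewrite res_exact ri.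
have [|p pE] := @hom_factor_inj _ _ _ _ i (aug_bd Q n) ii; first by rewrite dE.
have [K' [j [ij rj]]] := kernel_exists (aug_bd Q n).
have e := short_exact_factor ij rj ii dE pE.
exists K', j, (coh_delta H n e x).
by split; [exact: ij|exact: rj|exact: Iterated_deltaS ix pE].
Qed.

(** The kernel sheaves and the class [x] are fixed before [c] and [D], so a single homomorphism
    serves all diagrams. *)
Lemma cohomology_rho_S (A : gsheaf G) (Q : resolution G) m :
  exists rho : {additive resolution_cohomology Q A m.+1 -> H m.+1 A},
    forall (c : cocycle Q A m.+1) (D : cocycle_diagram c),
      Ext_coh (ext_class (bottom_row D)) (rho (coh_class c)).
Proof.
have [K [i [x [ii ri ix]]]] := iterated_delta_exists Q m.
have dE : range (aug_bd Q m) = range i by rewrite res_exact ri.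
have [|p pE] := @hom_factor_inj _ _ _ _ i (aug_bd Q m) ii; first by rewrite dE.
have [K' [j [ij rj]]] := kernel_exists (aug_bd Q m).
have e : short_exact j p := short_exact_factor ij rj ii dE pE.
have dj : range (aug_bd Q m.+1) = range j by rewrite rj; exact: res_exact.
(* [q] is the corestriction of [aug_bd Q m.+1] to the kernel sheaf [K']; a cocycle vanishes on its
   kernel and so induces [bar c] on [K']. *)
have [|q qE] := @hom_factor_inj _ _ _ _ j (aug_bd Q m.+1) ij; first by rewrite dj.
have kqE : hom_ker q = hom_ker (aug_bd Q m.+1).
  apply/seteqP; split=> z; rewrite !hom_kerE -qE comp_homE => qz.
    by rewrite qz hom_fzero.
  by apply: ij; rewrite qz hom_fzero.
have sq : range q = setT.
  apply/seteqP; split=> // k _.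
  have [z _ zk] : range (aug_bd Q m.+1) (j k) by rewrite dj; exists k.
  by exists z => //; apply: ij; rewrite (comp_hom_app _ qE).
have /choice[bar barE] (c : cocycle Q A m.+1) : exists k : ghom K' A,
    comp_hom k q = cocycle_hom c.
  by apply: hom_factor_surj => //; rewrite kqE; exact: cocycle_ker.
pose phi c := coh_map H m.+1 (bar c) (coh_delta H m e x).
have [|c [g cg]|rho rhoE] := @cohomology_lift G A Q m.+1 (H m.+1 A) phi.
- move=> c d; rewrite /phi -coh_mapB; congr (coh_map H _ _ _).
  by apply: (comp_hom_surjI sq); rewrite comp_homBl !barE cocycle_homB.
(* A coboundary through [g] induces [g] restricted along [j], which annihilates connecting
   images. *)
- rewrite /phi; suff -> : bar c = comp_hom g j by exact: coh_map_comp_delta.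
  by apply: (comp_hom_surjI sq); rewrite barE cg -qE comp_homA.
exists rho => c D; exists (bottom_row D); split=> //.
have [iD rD rb _] := cd_exact D.
have bE : range (cd_bd D) = range i by rewrite rb ri.
(* The row of [D] ends in the same cycles as [Q], so it splits over the same [K] and [x]. *)
have [|pD pDE] := @hom_factor_inj _ _ _ _ i (cd_bd D) ii; first by rewrite bE.
have eD : short_exact (cd_inj D) pD := short_exact_factor iD rD ii bE pDE.
exists K, i, x, pD, eD; split=> //.
rewrite rhoE /phi.
(* Naturality for the morphism of short exact sequences [bar c], [cd_vert D], identity. Its left
   square is checked after precomposing with the surjection [q], its right one after composing with
   the injection [i]. *)
rewrite (coh_delta_nat (s := H) e eD (a := bar c) (b := cd_vert D) (c := id_hom K)).
- by rewrite coh_map_id.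
- apply: (comp_hom_surjI sq).
  by rewrite -!comp_homA qE barE cd_square_c.
- apply: (comp_hom_injI ii).
  rewrite !comp_homA pDE cd_square_id -pE; congr (comp_hom _ p).
  exact: hom_ext.
Qed.

(** Uniqueness of the factorization makes it additive in the cocycle; the only coboundary in degree
    0 is zero. *)
Lemma cohomology_rho_0 (A : gsheaf G) (Q : resolution G) :
  exists rho : {additive resolution_cohomology Q A 0 -> H 0 A},
    forall (c : cocycle Q A 0) (ct : ghom (const_Z G) A),
      cocycle_hom c = comp_hom ct (aug_bd Q 0) -> rho (coh_class c) = coh_hom H A ct.
Proof.
have /choice[ct ctE] (c : cocycle Q A 0) : exists ct : ghom (const_Z G) A,
    cocycle_hom c = comp_hom ct (aug_bd Q 0).
  by have [k [kE _]] := cocycle_factor c; exists k.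
have ct_uniq c k : cocycle_hom c = comp_hom k (aug_bd Q 0) -> ct c = k.
  by move=> cE; apply: (comp_hom_surjI (res_exact Q 0)); rewrite -ctE.
have [|c c0|rho rhoE] := @cohomology_lift G A Q 0 (H 0 A) (fun c => coh_hom H A (ct c)).
- move=> c d; rewrite -raddfB; congr (coh_hom H A _); apply: ct_uniq.
  by rewrite comp_homBl -!ctE cocycle_homB.
- have c0' : cocycle_hom c = 0 := c0.
  by rewrite (ct_uniq c 0) ?raddf0 // c0' comp_hom0l.
by exists rho => c k /ct_uniq <-.
Qed.

End Cohomology.

Theorem proposition4p4 (G : etale_groupoid) (A : gsheaf G) (Q : resolution G) :
  (forall (m : nat) (c : cocycle Q A m.+1), inhabited (cocycle_diagram c)) /\
  (forall (m : nat) (c c' : cocycle Q A m.+1)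
      (D : cocycle_diagram c) (D' : cocycle_diagram c'),
    coh_class c = coh_class c' ->
    ext_class (bottom_row D) = ext_class (bottom_row D')) /\
  (forall c : cocycle Q A 0,
    exists! ct : ghom (const_Z G) A, cocycle_hom c = comp_hom ct (aug_bd Q 0)) /\
  (forall H : sheaf_cohomology G,
    (forall m : nat,
      exists rho : {additive resolution_cohomology Q A m.+1 -> H m.+1 A},
        forall (c : cocycle Q A m.+1) (D : cocycle_diagram c),
          Ext_coh (ext_class (bottom_row D)) (rho (coh_class c))) /\
    (exists rho : {additive resolution_cohomology Q A 0 -> H 0 A},
      forall (c : cocycle Q A 0) (ct : ghom (const_Z G) A),
        cocycle_hom c = comp_hom ct (aug_bd Q 0) -> rho (coh_class c) = coh_hom H A ct)).
Proof.
split; first exact: cocycle_diagram_exists.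
split.
  move=> m c c' D D' cc'; apply: ext_class_eq.
  exact: rst_step (bottom_row_map D D' cc').
split; first exact: cocycle_factor.
by move=> H; split=> [m|]; [exact: cohomology_rho_S|exact: cohomology_rho_0].
Qed.
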